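(* Let $(TM,\lambda)$ be an EAP-space. For the symmetric $d$-connection $\widehat D$ the curvature component $\widehat S^\alpha_{\beta bc}$ vanishes identically, and the remaining curvature tensors can be expressed in the form (with $|$, $||$ the covariant derivatives of the canonical $d$-connection and tildes denoting the curvature tensors of the dual $d$-connection): (a) $\widehat R^\alpha_{\beta\nu\mu}=\frac12(\Lambda^\alpha_{\beta\nu|\mu}-\Lambda^\alpha_{\beta\mu|\nu})+\frac14(\Lambda^\epsilon_{\beta\nu}\Lambda^\alpha_{\mu\epsilon}-\Lambda^\epsilon_{\beta\mu}\Lambda^\alpha_{\nu\epsilon})+\frac12\Lambda^\epsilon_{\nu\mu}\Lambda^\alpha_{\beta\epsilon}$, (b) $\widehat R^a_{b\nu\mu}=\frac12\widetilde R^a_{b\nu\mu}$, (c) $\widehat P^\alpha_{\beta\mu c}=\frac12\widetilde P^\alpha_{\beta\mu c}$, (d) $\widehat P^a_{b\mu c}=\frac12\widetilde P^a_{b\mu c}$, (e) $\widehat S^a_{bcd}=\frac12(T^a_{bc||d}-T^a_{bd||c})+\frac14(T^e_{bc}T^a_{de}-T^e_{bd}T^a_{ce})+\frac12T^e_{dc}T^a_{eb}$. Consequently, (f) $\widehat R_{\beta\nu}:=\widehat R^\alpha_{\beta\nu\alpha}=\frac12\widetilde R_{\beta\nu}-\frac14(C_\alpha\Lambda^\alpha_{\nu\beta}+\Lambda^\alpha_{\nu\epsilon}\Lambda^\epsilon_{\alpha\beta})$, (g) $\widehat{\mathcal R}:=g^{\beta\nu}\widehat R_{\beta\nu}=\frac12\widetilde{\mathcal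 R}-\frac14\Lambda^{\alpha\beta}{}_\epsilon\Lambda^\epsilon_{\alpha\beta}$, (h) $\widehat P_{\beta c}:=-\widehat P^\alpha_{\beta\alpha c}=\frac12\widetilde P_{\beta c}$, (i) $\widehat P_{b\mu}:=\widehat P^a_{b\mu a}=\frac12\widetilde P_{b\mu}$, (j) $\widehat S_{bd}:=\widehat S^a_{bda}=\frac12\widetilde S_{bd}-\frac14(C_aT^a_{db}+T^a_{de}T^e_{ab})$, (k) $\widehat{\mathcal S}:=g^{bd}\widehat S_{bd}=\frac12\widetilde{\mathcal S}-\frac14T^{ab}{}_eT^e_{ab}$.
   Context: Let $M$ be a smooth paracompact $n$-manifold, $TM$ its tangent bundle with induced local coordinates $(x^\mu,y^a)$, and $N=(N^a_\mu(x,y))$ a given nonlinear connection on $TM$. Greek indices denote horizontal and Latin indices vertical components; both run over $1,\dots,n$; repeated indices (including the mesh index $i$) are summed. Put $\dot\partial_a=\partial/\partial y^a$, $\delta_\mu=\partial/\partial x^\mu-N^a_\mu\dot\partial_a$ (adapted frame $(\delta_\mu,\dot\partial_a)$) and $R^a_{\mu\nu}=\delta_\nu N^a_\mu-\delta_\mu N^a_\nu$. A $d$-connection is a linear connection $D$ on $TM$ preserving by parallelism the horizontal and the vertical distribution; its coefficients $(\Gamma^\alpha_{\mu\nu},\Gamma^a_{b\nu},C^\alpha_{\mu c},C^a_{bc})$ are defined by $D_{\delta_\nu}\delta_\mu=\Gamma^\alpha_{\mu\nu}\delta_\alpha$, $D_{\delta_\nu}\dot\partial_b=\Gamma^a_{b\nu}\dot\partial_a$,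 $D_{\dot\partial_c}\delta_\mu=C^\alpha_{\mu c}\delta_\alpha$, $D_{\dot\partial_c}\dot\partial_b=C^a_{bc}\dot\partial_a$. Its $h$- and $v$-covariant derivatives are $T^{\alpha a}{}_{\beta b|\mu}=\delta_\mu T^{\alpha a}_{\beta b}+T^{\epsilon a}_{\beta b}\Gamma^\alpha_{\epsilon\mu}+T^{\alpha d}_{\beta b}\Gamma^a_{d\mu}-T^{\alpha a}_{\epsilon b}\Gamma^\epsilon_{\beta\mu}-T^{\alpha a}_{\beta d}\Gamma^d_{b\mu}$, $T^{\alpha a}{}_{\beta b||c}=\dot\partial_cT^{\alpha a}_{\beta b}+T^{\epsilon a}_{\beta b}C^\alpha_{\epsilon c}+T^{\alpha d}_{\beta b}C^a_{dc}-T^{\alpha a}_{\epsilon b}C^\epsilon_{\beta c}-T^{\alpha a}_{\beta d}C^d_{bc}$, similarly for other types. Its curvature $\mathbf R(X,Y)Z=D_XD_YZ-D_YD_XZ-D_{[X,Y]}Z$ has components $\mathbf R(\delta_\mu,\delta_\nu)\delta_\beta=R^\alpha_{\beta\mu\nu}\delta_\alpha$, $\mathbf R(\delta_\mu,\delta_\nu)\dot\partial_b=R^a_{b\mu\nu}\dot\partial_a$, $\mathbf R(\dot\partial_c,\delta_\nu)\delta_\beta=P^\alpha_{\beta\nu c}\delta_\alpha$, $\mathbf R(\dot\partial_c,\delta_\nu)\dot\partial_b=P^a_{b\nu c}\dot\partial_a$, $\mathbf R(\dot\partial_b,\dot\partial_c)\delta_\beta=S^\alpha_{\beta bc}\delta_\alpha$,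 $\mathbf R(\dot\partial_c,\dot\partial_d)\dot\partial_b=S^a_{bcd}\dot\partial_a$. Those of $\widetilde D$, $\widehat D$ carry a tilde, resp. a hat. EAP-space $(TM,\lambda)$: $TM$ with $N$ and $n$ vector fields $\lambda_i=\lambda_i^\alpha\delta_\alpha+\lambda_i^a\dot\partial_a$ ($i=1,\dots,n$) defined globally on $TM$ with linearly independent horizontal parts and linearly independent vertical parts. $(\lambda_{i\alpha})$, $(\lambda_{ia})$ are the inverse matrices of $(\lambda_i^\alpha)$, $(\lambda_i^a)$. Metric: $g_{\alpha\beta}=\lambda_{i\alpha}\lambda_{i\beta}$, $g_{ab}=\lambda_{ia}\lambda_{ib}$, with inverses $g^{\alpha\beta}$, $g^{ab}$. Canonical $d$-connection: $\Gamma^\alpha_{\mu\nu}=\lambda_i^\alpha\delta_\nu\lambda_{i\mu}$, $\Gamma^a_{b\nu}=\lambda_i^a\delta_\nu\lambda_{ib}$, $C^\alpha_{\mu c}=\lambda_i^\alpha\dot\partial_c\lambda_{i\mu}$, $C^a_{bc}=\lambda_i^a\dot\partial_c\lambda_{ib}$. Put $\Lambda^\alpha_{\mu\nu}=\Gamma^\alpha_{\mu\nu}-\Gamma^\alpha_{\nu\mu}$, $T^a_{bc}=C^a_{bc}-C^a_{cb}$, $C_\mu=\Lambda^\alpha_{\mu\alpha}$, $C_b=T^a_{ba}$, $\Lambda^{\alpha\beta}{}_\epsilon=g^{\beta\nu}\Lambda^\alpha_{\nu\epsilon}$, $T^{ab}{}_e=g^{bd}T^a_{de}$. Dual $d$-connection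 $\widetilde D$: $\widetilde\Gamma^\alpha_{\mu\nu}=\Gamma^\alpha_{\nu\mu}$, $\widetilde\Gamma^a_{b\mu}=\Gamma^a_{b\mu}$, $\widetilde C^\alpha_{\mu c}=C^\alpha_{\mu c}$, $\widetilde C^a_{bc}=C^a_{cb}$. Symmetric $d$-connection $\widehat D$: $\widehat\Gamma^\alpha_{\mu\nu}=\frac12(\Gamma^\alpha_{\mu\nu}+\Gamma^\alpha_{\nu\mu})$, $\widehat\Gamma^a_{b\mu}=\Gamma^a_{b\mu}$, $\widehat C^\alpha_{\mu c}=C^\alpha_{\mu c}$, $\widehat C^a_{bc}=\frac12(C^a_{bc}+C^a_{cb})$. Contractions for $\widetilde D$: $\widetilde R_{\beta\nu}=\widetilde R^\alpha_{\beta\nu\alpha}$, $\widetilde{\mathcal R}=g^{\beta\nu}\widetilde R_{\beta\nu}$, $\widetilde P_{\beta c}=-\widetilde P^\alpha_{\beta\alpha c}$, $\widetilde P_{b\mu}=\widetilde P^a_{b\mu a}$, $\widetilde S_{bd}=\widetilde S^a_{bda}$, $\widetilde{\mathcal S}=g^{bd}\widetilde S_{bd}$. *)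

(* Defs.v *)
From HB Require Import structures.
From mathcomp Require Import all_boot all_order all_algebra.
From mathcomp Require Import all_classical all_reals all_analysis.

Set Implicit Arguments.
Unset Strict Implicit.
Unset Printing Implicit Defensive.

Import Order.TTheory GRing.Theory Num.Theory.
Import numFieldNormedType.Exports.

Local Open Scope classical_set_scope.
Local Open Scope ring_scope.

(* Meant for open [U]. In finite dimension this is the usual notion: being
   C^(k+1) is being differentiable with all directional derivatives C^k. *)
Fixpoint Ck_on (R : realType) (V W : normedModType R) (U : set V) (k : nat)
    (f : V -> W) : Prop :=
  match k with
  | 0 => forall x, U x -> {for x, continuous f}
  | k'.+1 => (forall x, U x -> differentiable f x) /\
             forall v : V, Ck_on U k' ('D_v f)
  end.

Definition smooth_on (R : realType) (V W : normedModType R) (U : set V)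
    (f : V -> W) : Prop := forall k, Ck_on U k f.

Definition open_cover_of (T : topologicalType) (C : set (set T)) : Prop :=
  (forall U, C U -> open U) /\ forall x : T, exists2 U, C U & U x.

Definition paracompact (T : topologicalType) : Prop :=
  forall C : set (set T), open_cover_of C ->
  exists C' : set (set T),
    [/\ open_cover_of C',
        forall V, C' V -> exists2 U, C U & V `<=` U &
        forall x : T, exists2 W, nbhs x W &
          finite_set [set V | C' V /\ V `&` W !=set0]].

(* The coordinate maps and their inverses are total functions; only their
   values on [chart_dom c], resp. on its image, are meaningful. *)
Record smooth_manifold (R : realType) (n : nat) := SmoothManifold {
  carrier :> topologicalType;
  carrier_hausdorff : hausdorff_space carrier;
  carrier_paracompact : paracompact carrier;
  chart : Type;
  chart_dom : chart -> set carrier;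
  coord : chart -> carrier -> 'rV[R]_n;
  coord_inv : chart -> 'rV[R]_n -> carrier;
  chart_dom_open : forall c, open (chart_dom c);
  coord_open : forall c, open (coord c @` chart_dom c);
  coordK : forall c, {in chart_dom c, cancel (coord c) (coord_inv c)};
  coord_continuous : forall c, {within chart_dom c, continuous (coord c)};
  coord_inv_continuous : forall c,
    {within coord c @` chart_dom c, continuous (coord_inv c)};
  chart_cover : forall p : carrier, exists c, chart_dom c p;
  chart_compat : forall c c',
    smooth_on (coord c @` (chart_dom c `&` chart_dom c'))
              (coord c' \o coord_inv c) }.

Arguments coord {R n} s c p.
Arguments coord_inv {R n} s c x.
Arguments chart_dom {R n} s c.

(* Each chart c of M induces a chart of TM with coordinates z = (x, y); the
   points of TM over [chart_dom c] are identified with [tm_dom M c]. *)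
Notation coordTM R n := ('rV[R]_n * 'rV[R]_n)%type.

Section TangentBundle.
Context {R : realType} {n : nat} (M : smooth_manifold R n).

Definition trans (c c' : chart M) : 'rV[R]_n -> 'rV[R]_n :=
  coord M c' \o coord_inv M c.

Definition tm_dom (c : chart M) : set (coordTM R n) :=
  [set z | (coord M c @` chart_dom M c) z.1].

Definition tm_overlap (c c' : chart M) : set (coordTM R n) :=
  [set z | (coord M c @` (chart_dom M c `&` chart_dom M c')) z.1].

Definition tm_trans (c c' : chart M) (z : coordTM R n) : coordTM R n :=
  (trans c c' z.1, 'd (trans c c') (z.1) (z.2)).

End TangentBundle.

(* [N z a mu] is N^a_mu (z), in a fixed chart of TM. The horizontal lift of
   v = v^mu d/dx^mu is v^mu (d/dx^mu - N^a_mu d/dy^a). *)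
Definition hlift (R : realType) (n : nat) (N : coordTM R n -> 'M[R]_n)
    (z : coordTM R n) (v : 'rV[R]_n) : coordTM R n :=
  (v, - (v *m (N z)^T)).

(* [ncoeff_compat] states that the horizontal distributions spanned in the
   charts are one and the same; it encodes the transformation law of N. *)
Record nonlinear_connection (R : realType) (n : nat) (M : smooth_manifold R n)
  := NonlinearConnection {
  ncoeff :> chart M -> coordTM R n -> 'M[R]_n;
  ncoeff_smooth : forall c a mu,
    smooth_on (tm_dom c) (fun z => ncoeff c z a mu : R^o);
  ncoeff_compat : forall (c c' : chart M) z, tm_overlap c c' z ->
    forall v, 'd (tm_trans c c') z (hlift (ncoeff c) z v) =
      hlift (ncoeff c') (tm_trans c c' z) ('d (trans c c') (z.1) v) }.

(* [vf c z] lists the components of the vector in the natural frame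
   (d/dx^mu, d/dy^a) of the chart c. *)
Record tm_vector_field (R : realType) (n : nat) (M : smooth_manifold R n)
  := TMVectorField {
  vf :> chart M -> coordTM R n -> coordTM R n;
  vf_smooth : forall c, smooth_on (tm_dom c) (vf c);
  vf_compat : forall (c c' : chart M) z, tm_overlap c c' z ->
    'd (tm_trans c c') z (vf c z) = vf c' (tm_trans c c' z) }.

(* From here on, N and the vector fields X, Y, ... are given in a fixed chart
   of TM; Greek and Latin indices both range over 'I_n. *)
Section LocalGeometry.
Context {R : realType} {n : nat}.
Local Notation E := (coordTM R n).
Implicit Types (N : E -> 'M[R]_n) (X Y Z : E -> E) (f : E -> R).

Definition delta N (mu : 'I_n) : E -> E := fun z => hlift N z (delta_mx 0 mu).
Definition vdel (a : 'I_n) : E -> E := fun=> (0, delta_mx 0 a).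

(* X = hcomp X alpha * delta_alpha + vcomp X a * vdel_a *)
Definition hcomp X (alpha : 'I_n) : E -> R := fun z => (X z).1 0 alpha.
Definition vcomp N X (a : 'I_n) : E -> R :=
  fun z => (X z).2 0 a + \sum_(mu < n) N z a mu * (X z).1 0 mu.

Definition hpart N X : E -> E :=
  fun z => \sum_(alpha < n) hcomp X alpha z *: delta N alpha z.
Definition vpart N X : E -> E :=
  fun z => \sum_(a < n) vcomp N X a z *: vdel a z.

Definition along X f : E -> R := fun z => 'D_(X z) (f : E -> R^o) z.

Definition lie_bracket X Y : E -> E := fun z => 'D_(X z) Y z - 'D_(Y z) X z.

(* Coefficients of a d-connection in the adapted frame, the upper index first:
   Ghh = Gamma^alpha_(mu nu), Gvh = Gamma^a_(b nu),
   Chv = C^alpha_(mu c),      Cvv = C^a_(b c). *)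
Record dconnection := DConnection {
  Ghh : 'I_n -> 'I_n -> 'I_n -> E -> R;
  Gvh : 'I_n -> 'I_n -> 'I_n -> E -> R;
  Chv : 'I_n -> 'I_n -> 'I_n -> E -> R;
  Cvv : 'I_n -> 'I_n -> 'I_n -> E -> R }.
Implicit Types (D : dconnection).

(* The linear connection with these coefficients: [nabla N D X Y] is D_X Y. *)
Definition nabla_h N D X Y (alpha : 'I_n) : E -> R := fun z =>
  along X (hcomp Y alpha) z +
  \sum_(mu < n) hcomp Y mu z *
    (\sum_(nu < n) hcomp X nu z * Ghh D alpha mu nu z +
     \sum_(c < n) vcomp N X c z * Chv D alpha mu c z).
Definition nabla_v N D X Y (a : 'I_n) : E -> R := fun z =>
  along X (vcomp N Y a) z +
  \sum_(b < n) vcomp N Y b z *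
    (\sum_(nu < n) hcomp X nu z * Gvh D a b nu z +
     \sum_(c < n) vcomp N X c z * Cvv D a b c z).
Definition nabla N D X Y : E -> E := fun z =>
  \sum_(alpha < n) nabla_h N D X Y alpha z *: delta N alpha z +
  \sum_(a < n) nabla_v N D X Y a z *: vdel a z.

Definition curv N D X Y Z : E -> E := fun z =>
  nabla N D X (nabla N D Y Z) z - nabla N D Y (nabla N D X Z) z
  - nabla N D (lie_bracket X Y) Z z.

(* R^alpha_(beta mu nu), R^a_(b mu nu), P^alpha_(beta nu c), P^a_(b nu c),
   S^alpha_(beta b c), S^a_(b c d), with the indices in this order *)
Definition Rh N D (alpha beta mu nu : 'I_n) : E -> R :=
  hcomp (curv N D (delta N mu) (delta N nu) (delta N beta)) alpha.
Definition Rv N D (a b mu nu : 'I_n) : E -> R :=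
  vcomp N (curv N D (delta N mu) (delta N nu) (vdel b)) a.
Definition Ph N D (alpha beta nu c : 'I_n) : E -> R :=
  hcomp (curv N D (vdel c) (delta N nu) (delta N beta)) alpha.
Definition Pv N D (a b nu c : 'I_n) : E -> R :=
  vcomp N (curv N D (vdel c) (delta N nu) (vdel b)) a.
Definition Sh N D (alpha beta b c : 'I_n) : E -> R :=
  hcomp (curv N D (vdel b) (vdel c) (delta N beta)) alpha.
Definition Sv N D (a b c d : 'I_n) : E -> R :=
  vcomp N (curv N D (vdel c) (vdel d) (vdel b)) a.

Definition Rich N D (beta nu : 'I_n) : E -> R :=
  fun z => \sum_(alpha < n) Rh N D alpha beta nu alpha z.
Definition Pch N D (beta c : 'I_n) : E -> R :=
  fun z => - \sum_(alpha < n) Ph N D alpha beta alpha c z.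
Definition Pcv N D (b mu : 'I_n) : E -> R :=
  fun z => \sum_(a < n) Pv N D a b mu a z.
Definition Ricv N D (b d : 'I_n) : E -> R :=
  fun z => \sum_(a < n) Sv N D a b d a z.

(* T^alpha_(beta nu | mu) for horizontal T and T^a_(b c || d) for vertical T *)
Definition hcov N D (T : 'I_n -> 'I_n -> 'I_n -> E -> R)
    (alpha beta nu mu : 'I_n) : E -> R := fun z =>
  along (delta N mu) (T alpha beta nu) z
  + \sum_(e < n) T e beta nu z * Ghh D alpha e mu z
  - \sum_(e < n) T alpha e nu z * Ghh D e beta mu z
  - \sum_(e < n) T alpha beta e z * Ghh D e nu mu z.
Definition vcov D (T : 'I_n -> 'I_n -> 'I_n -> E -> R)
    (a b c d : 'I_n) : E -> R := fun z =>
  along (vdel d) (T a b c) z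
  + \sum_(e < n) T e b c z * Cvv D a e d z
  - \sum_(e < n) T a e c z * Cvv D e b d z
  - \sum_(e < n) T a b e z * Cvv D e c d z.

Definition htors D (alpha mu nu : 'I_n) : E -> R :=
  fun z => Ghh D alpha mu nu z - Ghh D alpha nu mu z.
Definition vtors D (a b c : 'I_n) : E -> R :=
  fun z => Cvv D a b c z - Cvv D a c b z.
Definition hcontr D (mu : 'I_n) : E -> R :=
  fun z => \sum_(alpha < n) htors D alpha mu alpha z.
Definition vcontr D (b : 'I_n) : E -> R :=
  fun z => \sum_(a < n) vtors D a b a z.

Definition dual_dconn D : dconnection := DConnection
  (fun alpha mu nu => Ghh D alpha nu mu) (Gvh D) (Chv D)
  (fun a b c => Cvv D a c b).
Definition symmetric_dconn D : dconnection := DConnection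
  (fun alpha mu nu z => (Ghh D alpha mu nu z + Ghh D alpha nu mu z) / 2)
  (Gvh D) (Chv D)
  (fun a b c z => (Cvv D a b c z + Cvv D a c b z) / 2).

(* [lam i] is the vector field lambda_i *)
Implicit Types (lam : 'I_n -> E -> E).

Definition hframe lam (z : E) : 'M[R]_n :=
  \matrix_(i < n, alpha < n) hcomp (lam i) alpha z.
Definition vframe N lam (z : E) : 'M[R]_n :=
  \matrix_(i < n, a < n) vcomp N (lam i) a z.
(* lambda_(i alpha) and lambda_(i a) *)
Definition hcoframe lam (i alpha : 'I_n) : E -> R :=
  fun z => invmx (hframe lam z) alpha i.
Definition vcoframe N lam (i a : 'I_n) : E -> R :=
  fun z => invmx (vframe N lam z) a i.

Definition canonical_dconn N lam : dconnection := DConnection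
  (fun alpha mu nu z => \sum_(i < n)
     hcomp (lam i) alpha z * along (delta N nu) (hcoframe lam i mu) z)
  (fun a b nu z => \sum_(i < n)
     vcomp N (lam i) a z * along (delta N nu) (vcoframe N lam i b) z)
  (fun alpha mu c z => \sum_(i < n)
     hcomp (lam i) alpha z * along (vdel c) (hcoframe lam i mu) z)
  (fun a b c z => \sum_(i < n)
     vcomp N (lam i) a z * along (vdel c) (vcoframe N lam i b) z).

Definition hmetric lam (z : E) : 'M[R]_n := \matrix_(alpha < n, beta < n)
  \sum_(i < n) hcoframe lam i alpha z * hcoframe lam i beta z.
Definition vmetric N lam (z : E) : 'M[R]_n := \matrix_(a < n, b < n)
  \sum_(i < n) vcoframe N lam i a z * vcoframe N lam i b z.
(* g^(alpha beta) and g^(a b) *)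
Definition hmetric_inv lam (alpha beta : 'I_n) : E -> R :=
  fun z => invmx (hmetric lam z) alpha beta.
Definition vmetric_inv N lam (a b : 'I_n) : E -> R :=
  fun z => invmx (vmetric N lam z) a b.

(* Lambda^(alpha beta)_epsilon and T^(a b)_e *)
Definition htors_raised lam D (alpha beta e : 'I_n) : E -> R := fun z =>
  \sum_(nu < n) hmetric_inv lam beta nu z * htors D alpha nu e z.
Definition vtors_raised N lam D (a b e : 'I_n) : E -> R := fun z =>
  \sum_(d < n) vmetric_inv N lam b d z * vtors D a d e z.

Definition scalar_h N lam D : E -> R := fun z =>
  \sum_(beta < n) \sum_(nu < n) hmetric_inv lam beta nu z * Rich N D beta nu z.
Definition scalar_v N lam D : E -> R := fun z =>
  \sum_(b < n) \sum_(d < n) vmetric_inv N lam b d z * Ricv N D b d z.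

End LocalGeometry.

Record eap_space (R : realType) (n : nat) (M : smooth_manifold R n)
  (N : nonlinear_connection M) := EAPSpace {
  eap_lambda :> 'I_n -> tm_vector_field M;
  eap_hfree : forall (c : chart M) z, tm_dom c z -> forall k : 'I_n -> R,
    \sum_(i < n) k i *: hpart (N c) (eap_lambda i c) z = 0 -> forall i, k i = 0;
  eap_vfree : forall (c : chart M) z, tm_dom c z -> forall k : 'I_n -> R,
    \sum_(i < n) k i *: vpart (N c) (eap_lambda i c) z = 0 -> forall i, k i = 0 }.

(* Main.v *)
(* The curvature of any d-connection on the horizontal (resp. vertical) bundle
   is that of its connection form in the adapted frame.  The canonical
   connection makes the lambda_i parallel, so both its curvatures vanish:
   with H the matrix of the frame and K its inverse, its connection form is
   (X K) H = - K (X H), and flatness reduces to [X, Y] H = X Y H - Y X H.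
   The dual and the symmetric connections are the members t = 1 and t = 1/2 of
   the pencil D - t * (torsion), whose curvature at a point is therefore
   - t d_D A + t^2 (A /\ A) with A the torsion.  In (b), (c), (d) the quadratic
   term is absent, hence the factor 1/2; in (f), (j) comparing t = 1/2 with
   half of t = 1 leaves - 1/4 (A /\ A). *)

Require Import Defs.
From HB Require Import structures.
From mathcomp Require Import all_boot all_order all_algebra.
From mathcomp Require Import all_classical all_reals all_analysis.
From mathcomp Require Import ring lra.

Set Implicit Arguments.
Unset Strict Implicit.
Unset Printing Implicit Defensive.

Import Order.TTheory GRing.Theory Num.Theory.
Import numFieldNormedType.Exports.

Local Open Scope ring_scope.

(** * Symmetry of second derivatives *)

(** The canonical coefficients contain derivatives of the coframe and the curvature differentiates
    them once more, which would ask for two derivatives of an inverse matrix. The form - K (X H)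
    avoids this: the frame H is C^2, and K need only be differentiable, which the cofactor formula
    gives. Hence the working regularity C^2 on an open set.

    For fields with variable components, [X, Y] f = X Y f - Y X f rests on the symmetry of mixed
    directional derivatives, proved for [Ck_on] from the mean value theorem.

    The torsion A has two parts: on the horizontal bundle it sees only the horizontal part of its
    argument ([htwist]), on the vertical bundle only the vertical part ([vtwist]). So for (b), (c),
    (d) a factor of A /\ A vanishes. In (b) only A on the bracket of two horizontal fields survives,
    that is, the curvature of N.

    The coefficients 1/2, 1/4, 1/2 in (a) and (e) are t, t^2, t at t = 1/2. The last term there
    compensates the correction that [hcov] and [vcov] make on the third index of the torsion, which
    d_D A lacks. *)

Section Schwarz.
Context {R : realType} {V : normedModType R}.
Implicit Types (f g : V -> R^o) (U : set V) (u v w z : V).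

(** Brings directional derivatives within reach of the one-variable mean value theorem. *)
Lemma is_derive_line f w u (s : R) : derivable f (w + s *: u) u ->
  is_derive s 1 (fun r : R => f (w + r *: u)) ('D_u f (w + s *: u)).
Proof.
move=> df.
have E0 (h : R) : w + (h *: (1 : R^o) + s) *: u = h *: u + (w + s *: u).
  rewrite (_ : h *: (1 : R^o) = h); last by rewrite [LHS]mulr1.
  by rewrite scalerDl addrCA.
have E : (fun h : R => h^-1 *: ((((fun r : R => f (w + r *: u)) : R -> R^o)
              \o shift s) (h *: 1) - f (w + s *: u)))
   = (fun h : R => h^-1 *: ((f \o shift (w + s *: u)) (h *: u)
              - f (w + s *: u))).
  by apply/funext => h; rewrite /= E0.
by split; [rewrite /derivable E | rewrite /derive E].
Qed.

(** The mean value theorem is applied twice, first in the direction [u], then in the direction [v].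
    The left-hand side is symmetric in [u] and [v] while the right-hand side fixes an order of
    differentiation; this asymmetry yields the symmetry of second derivatives. *)
Lemma second_difference U f u v z (h : R) : open U -> Ck_on U 2 f -> 0 < h ->
  (forall s t : R, 0 <= s <= h -> 0 <= t <= h -> U (z + s *: u + t *: v)) ->
  exists s t : R, [/\ 0 <= s <= h, 0 <= t <= h &
    f (z + h *: u + h *: v) - f (z + h *: u) - (f (z + h *: v) - f z)
    = h * h * 'D_v ('D_u f) (z + s *: u + t *: v)].
Proof.
move=> oU [df /(_ u) [dDf _]] h0 Uh.
have h00 : 0 <= (0 : R) <= h by rewrite lexx ltW.
have hh : 0 <= h <= h by rewrite lexx ltW.
have Uh0 s : 0 <= s <= h -> U (z + s *: u).
  by move=> hs; have := Uh s 0 hs h00; rewrite scale0r addr0.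
(* The second difference is [phi h - phi 0]. *)
pose phi := fun s : R => f ((z + h *: v) + s *: u) - f (z + s *: u).
pose dphi := fun s : R => 'D_u f ((z + h *: v) + s *: u) - 'D_u f (z + s *: u).
have Dphi s : 0 <= s <= h -> is_derive s 1 phi (dphi s).
  move=> hs; apply: is_deriveB; apply: is_derive_line;
    apply: diff_derivable; apply: df.
    by rewrite addrAC; apply: Uh.
  exact: Uh0.
have itvW (x : R) : x \in `]0, h[ -> 0 <= x <= h.
  by rewrite in_itv /= => /andP[a b]; rewrite !ltW.
have [||s /itvW hs es] := @MVT _ phi dphi 0 h h0.
- by move=> x /itvW; apply: Dphi.
- apply: derivable_within_continuous => x; rewrite in_itv /= => hx.
  by have [] := Dphi x hx.
pose psi := fun t : R => 'D_u f ((z + s *: u) + t *: v).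
pose dpsi := fun t : R => 'D_v ('D_u f) ((z + s *: u) + t *: v).
have Dpsi t : 0 <= t <= h -> is_derive t 1 psi (dpsi t).
  move=> ht; apply: is_derive_line; apply: diff_derivable; apply: dDf.
  exact: Uh.
have [||t /itvW ht et] := @MVT _ psi dpsi 0 h h0.
- by move=> x /itvW; apply: Dpsi.
- apply: derivable_within_continuous => x; rewrite in_itv /= => hx.
  by have [] := Dpsi x hx.
exists s, t; split => //.
move: es et; rewrite /phi /dphi /psi /dpsi !subr0 !scale0r !addr0.
rewrite ![z + h *: v + _]addrAC => es et.
by rewrite es et; ring.
Qed.

Lemma nbhs_parallelogram (W : set V) z u v : nbhs z W ->
  exists2 h : R, 0 < h &
    forall s t : R, 0 <= s <= h -> 0 <= t <= h -> W (z + s *: u + t *: v).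
Proof.
move=> /nbhs_ballP [e /= e0 eW].
have p0 : 0 < `|u| + `|v| + 1 by rewrite ltr_pwDr// addr_ge0.
(* The summand 1 covers the case where both vectors are zero and makes the final bound strict. *)
exists (e / (`|u| + `|v| + 1)); first exact: divr_gt0.
move=> s t /andP[s0 sh] /andP[t0 th]; apply: eW.
rewrite -ball_normE /= -addrA opprD addrA subrr sub0r normrN.
apply: (le_lt_trans (ler_normD _ _)); rewrite !normrZ !ger0_norm//.
apply: (@le_lt_trans _ _ (e / (`|u| + `|v| + 1) * (`|u| + `|v|))).
  by rewrite mulrDr lerD// ler_wpM2r.
by rewrite mulrAC ltr_pdivrMr// ltr_pM2l// ltrDl.
Qed.

(** One second difference, divided by [h * h], equals each of the two mixed derivatives at some
    point of an arbitrarily small parallelogram; continuity at [z] closes the gap up to any [e]. *)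
Lemma derive_comm U f u v z : open U -> U z -> Ck_on U 2 f ->
  'D_u ('D_v f) z = 'D_v ('D_u f) z.
Proof.
move=> oU Uz C2f.
apply/eqP; rewrite -subr_eq0 -normr_le0; apply/ler_addgt0Pr => e e0.
have [_ C1] := C2f.
have cuv := (C1 v).2 u z Uz; have cvu := (C1 u).2 v z Uz.
have e20 : 0 < e / 2 by rewrite divr_gt0.
move/cvgrPdist_lt: cuv => /(_ _ e20) n1.
move/cvgrPdist_lt: cvu => /(_ _ e20) n2.
have [h h0 Wh] := nbhs_parallelogram u v
  (filterI (open_nbhs_nbhs (conj oU Uz)) (filterI n1 n2)).
have [s [t [hs ht E1]]] := second_difference oU C2f h0
  (fun s t hs ht => (Wh s t hs ht).1).
(* The roles of [u] and [v] are exchanged, so the intermediate point is another one. *)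
have [|t' [s' [ht' hs' E2]]] := @second_difference U f v u z h oU C2f h0.
  by move=> s' t' hs' ht'; rewrite addrAC; have [] := Wh t' s' ht' hs'.
have h2 : h * h != 0 by rewrite mulf_neq0// gt_eqF.
have [_ [_ /= d2]] := Wh s t hs ht.
have [_ [/= d1 _]] := Wh s' t' hs' ht'.
rewrite (addrAC z (s' *: u)) in d1.
rewrite (addrAC z (h *: v)) in E2.
move: E1 E2 d1 d2.
move: ('D_v ('D_u f) (z + s *: u + t *: v)) => D1.
move: ('D_u ('D_v f) (z + t' *: v + s' *: u)) => D2.
move: ('D_v ('D_u f) z) ('D_u ('D_v f) z) => D3 D4.
move: (f _) (f _) (f _) (f z) => f1 f2 f3 f4 E1 E2 d1 d2.
have {E1 E2} E : D1 = D2.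
  by apply: (mulfI h2); rewrite -E1 -E2; ring.
rewrite add0r (splitr e) ltW//.
rewrite -E in d1.
by rewrite (le_lt_trans (ler_distD D1 _ _)) // ltrD // distrC.
Qed.

End Schwarz.

(** * Stability of C^k *)

Section Ck.
Context {R : realType} {V : normedModType R}.
Implicit Types (U : set V) (u v w z : V).

(** The first-order expansion of [f] at [z] is one of [g] with the same differential. This is used
    wherever a formula for a function holds only on the open set. *)
Lemma near_eq_differentiable (W : normedModType R) (f g : V -> W) z :
  {near z, f =1 g} -> differentiable f z -> differentiable g z.
Proof.
move=> fg /diff_locallyP[cdf /eqaddoP fE].
have fgz : f z = g z := nbhs_singleton fg.
have gE : g \o shift z = cst (g z) + 'd f z +o_ 0 id.
  apply/eqaddoP => e e0.
  have n0 : \forall y \near (0 : V), f (y + z) = g (y + z).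
    by move: fg; rewrite (near_shift 0 z); apply: filterS => y; rewrite /= subr0.
  apply: filterS2 n0 (fE e e0) => y E.
  by rewrite !fctE /= E fgz.
by apply/diff_locallyP; rewrite (diff_unique cdf gE).
Qed.

Lemma near_open U (W : Type) (f g : V -> W) z : open U -> U z ->
  (forall x, U x -> f x = g x) -> {near z, f =1 g}.
Proof.
move=> oU Uz fg; apply: filterS (open_nbhs_nbhs (conj oU Uz)) => x /fg //.
Qed.

(** [Ck_on] speaks of total functions, but the rules of derivation hold only at points of [U]; the
    inductions below use this to replace a derivative by its formula. *)
Lemma Ck_on_eq (W : normedModType R) U k (f g : V -> W) : open U ->
  (forall x, U x -> f x = g x) -> Ck_on U k f -> Ck_on U k g.
Proof.
move=> oU; elim: k f g => [|k IH] f g fg.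
  move=> cf x Ux; rewrite /prop_for /continuous_at -fg //.
  apply: cvg_trans (cf x Ux); apply: near_eq_cvg.
  by apply: near_open oU Ux _ => y Uy; rewrite fg.
move=> [df Df]; split=> [x Ux|v].
  by apply: near_eq_differentiable (df x Ux); apply: near_open oU Ux fg.
apply: IH (Df v) => x Ux; apply: near_eq_derive.
exact: near_open oU Ux fg.
Qed.

Lemma Ck_onW (W : normedModType R) U k (f : V -> W) :
  Ck_on U k.+1 f -> Ck_on U k f.
Proof.
elim: k f => [|k IH] f [df Df].
  by move=> x Ux; apply: differentiable_continuous; apply: df.
by split=> // v; apply: IH.
Qed.

Lemma Ck_on_cst (W : normedModType R) U k (a : W) : Ck_on U k (fun=> a : W).
Proof.
elim: k a => [|k IH] a; first by move=> x _; apply: cst_continuous.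
split=> [x _|v]; first exact: differentiable_cst.
rewrite (_ : 'D_v _ = fun=> 0); first exact: IH.
by apply/funext => x; apply: derive_cst.
Qed.

Lemma Ck_onD (W : normedModType R) U k (f g : V -> W) : open U ->
  Ck_on U k f -> Ck_on U k g -> Ck_on U k (fun x => f x + g x).
Proof.
move=> oU; elim: k f g => [|k IH] f g.
  by move=> cf cg x Ux; apply: cvgD; [apply: cf|apply: cg].
move=> [df Df] [dg Dg]; split=> [x Ux|v].
  by apply: differentiableD; [apply: df|apply: dg].
apply: Ck_on_eq oU _ (IH _ _ (Df v) (Dg v)) => x Ux.
by rewrite -deriveD //; apply: diff_derivable; [apply: df|apply: dg].
Qed.

Lemma Ck_onM U k (f g : V -> R^o) : open U ->
  Ck_on U k f -> Ck_on U k g -> Ck_on U k (fun x => f x * g x : R^o).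
Proof.
move=> oU; elim: k f g => [|k IH] f g.
  by move=> cf cg x Ux; apply: cvgM; [apply: cf|apply: cg].
move=> Cf Cg; have [df Df] := Cf; have [dg Dg] := Cg; split=> [x Ux|v].
  by apply: differentiableM; [apply: df|apply: dg].
(* The Leibniz rule keeps one factor undifferentiated, so its regularity is lowered by one to match
   the induction hypothesis. *)
apply: Ck_on_eq oU _ (Ck_onD oU (IH _ _ (Ck_onW Cf) (Dg v))
  (IH _ _ (Ck_onW Cg) (Df v))) => x Ux.
by rewrite (@deriveM _ _ f g) //; apply: diff_derivable; [apply: df|apply: dg].
Qed.

Lemma Ck_on_sum (W : normedModType R) U k m (f : 'I_m -> V -> W) : open U ->
  (forall i, Ck_on U k (f i)) -> Ck_on U k (fun x => \sum_(i < m) f i x).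
Proof.
move=> oU; elim: m f => [|m IH] f Cf.
  by under eq_fun do rewrite big_ord0; apply: Ck_on_cst.
by under eq_fun do rewrite big_ord_recl; apply: Ck_onD => //; apply: IH.
Qed.

Lemma Ck_on_linear (W W' : normedModType R) U k (f : V -> W)
    (l : {linear W -> W'}) : open U -> continuous l ->
  Ck_on U k f -> Ck_on U k (fun x => l (f x)).
Proof.
move=> oU cl; elim: k f => [|k IH] f.
  by move=> cf x Ux; apply: continuous_comp; [apply: cf|apply: cl].
have dl y : differentiable l y by apply: linear_differentiable.
move=> [df Df]; split=> [x Ux|v].
  by apply: differentiable_comp; [apply: df|apply: dl].
apply: Ck_on_eq oU _ (IH _ (Df v)) => x Ux.
rewrite [RHS]deriveE; last by apply: differentiable_comp; [apply: df|apply: dl].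
by rewrite diff_comp ?diff_lin //= -?deriveE //; apply: df.
Qed.

End Ck.

(** * Directional derivatives on TM *)

Section Along.
Context {R : realType} {n : nat}.
Local Notation E := (coordTM R n).
Implicit Types (X Y : E -> E) (f g : E -> R) (U : set E) (v w z : E).

(** All 2n natural components are put under one index. The natural frame is made of constant
    vectors, so [derive_comm] applies to it; the fields [delta] vary with the point. *)
Definition tm_coord (k : 'I_(n + n)) (v : E) : R^o := row_mx v.1 v.2 0 k.

Definition tm_basis (k : 'I_(n + n)) : E :=
  (lsubmx (delta_mx 0 k), rsubmx (delta_mx 0 k)).

Lemma tm_coord_is_linear k : linear (tm_coord k).
Proof.
move=> a u v; rewrite /tm_coord /=.
by rewrite -add_row_mx -scale_row_mx mxE [X in X + _]mxE.
Qed.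

HB.instance Definition _ k :=
  GRing.isLinear.Build R E R^o _ (tm_coord k) (tm_coord_is_linear k).

Lemma tm_coord_continuous k : continuous (tm_coord k).
Proof.
move=> v; rewrite -(splitK k); case: (fintype.split k) => i /=.
  rewrite (_ : tm_coord _ = fun v : E => v.1 0 i); last first.
    by apply/funext => w; rewrite /tm_coord row_mxEl.
  apply: (@continuous_comp _ _ _ fst (fun u : 'rV[R]_n => u 0 i)).
    exact: cvg_fst.
  exact: coord_continuous.
rewrite (_ : tm_coord _ = fun v : E => v.2 0 i); last first.
  by apply/funext => w; rewrite /tm_coord row_mxEr.
  apply: (@continuous_comp _ _ _ snd (fun u : 'rV[R]_n => u 0 i)).
    exact: cvg_snd.
  exact: coord_continuous.
Qed.

Lemma tm_coordE v : v = \sum_k tm_coord k v *: tm_basis k.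
Proof.
have <- : (lsubmx (row_mx v.1 v.2), rsubmx (row_mx v.1 v.2)) = v.
  by rewrite row_mxKl row_mxKr -surjective_pairing.
rewrite {1 2}(row_sum_delta (row_mx v.1 v.2)) !linear_sum /=.
apply: injective_projections => /=.
  rewrite (big_morph fst (id1 := 0) (op1 := +%R)) //.
  apply: eq_bigr => k _; rewrite linearZ /=.
  by rewrite /tm_coord /= row_mxKl row_mxKr.
rewrite (big_morph snd (id1 := 0) (op1 := +%R)) //.
apply: eq_bigr => k _; rewrite linearZ /=.
by rewrite /tm_coord /= row_mxKl row_mxKr.
Qed.

Lemma derive_tm_basis (W : normedModType R) (f : E -> W) v z : differentiable f z ->
  'D_v f z = \sum_k tm_coord k v *: 'D_(tm_basis k) f z.
Proof.
move=> df; rewrite deriveE // {1}(tm_coordE v) linear_sum.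
by apply: eq_bigr => k _; rewrite linearZ deriveE.
Qed.

Lemma differentiable_tm_coord X k z : differentiable X z ->
  differentiable (fun w => tm_coord k (X w)) z.
Proof.
move=> dX; apply: differentiable_comp => //.
by apply: linear_differentiable; apply: tm_coord_continuous.
Qed.

Lemma derive_tm_coord X k v z : differentiable X z ->
  'D_v (fun w => tm_coord k (X w)) z = tm_coord k ('D_v X z).
Proof.
move=> dX; rewrite deriveE; last exact: differentiable_tm_coord.
rewrite diff_comp //=; last first.
  by apply: linear_differentiable; apply: tm_coord_continuous.
rewrite diff_lin ?deriveE //; exact: tm_coord_continuous.
Qed.

Local Notation diff_at f z := (differentiable (f : E -> R^o) z).

Lemma alongD X f g z : diff_at f z -> diff_at g z ->
  along X (fun w => f w + g w) z = along X f z + along X g z.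
Proof. by move=> df dg; apply: deriveD; apply: diff_derivable. Qed.

Lemma alongN X f z : diff_at f z -> along X (fun w => - f w) z = - along X f z.
Proof. by move=> df; apply: deriveN; apply: diff_derivable. Qed.

Lemma along_cst X (a : R) z : along X (fun=> a) z = 0.
Proof. exact: derive_cst. Qed.

Lemma alongM X f g z : diff_at f z -> diff_at g z ->
  along X (fun w => f w * g w) z = f z * along X g z + g z * along X f z.
Proof. by move=> df dg; apply: deriveM; apply: diff_derivable. Qed.

Lemma diff_at_sum m (f : 'I_m -> E -> R) z : (forall i, diff_at (f i) z) ->
  diff_at (fun w => \sum_(i < m) f i w) z.
Proof.
move=> df; rewrite (_ : (fun _ => _) = (\sum_(i < m) (f i : E -> R^o))).
  exact: differentiable_sum.
by apply/funext => w; rewrite fct_sumE.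
Qed.

Lemma along_sum X m (f : 'I_m -> E -> R) z : (forall i, diff_at (f i) z) ->
  along X (fun w => \sum_(i < m) f i w) z = \sum_(i < m) along X (f i) z.
Proof.
move=> df; rewrite (_ : (fun _ => _) = (\sum_(i < m) (f i : E -> R^o))).
  by apply: derive_sum => i; apply: diff_derivable.
by apply/funext => w; rewrite fct_sumE.
Qed.

Lemma along_near X f g z : {near z, f =1 g} -> along X f z = along X g z.
Proof. by move=> fg; apply: near_eq_derive. Qed.

Lemma along_basisE X f z : diff_at f z ->
  along X f z = \sum_k tm_coord k (X z) * 'D_(tm_basis k) (f : E -> R^o) z.
Proof. by move=> df; rewrite /along derive_tm_basis. Qed.

Lemma diff_at_along_basis U f Y z : open U -> U z -> Ck_on U 2 (f : E -> R^o) ->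
  differentiable Y z ->
  diff_at (fun w => \sum_k tm_coord k (Y w) * 'D_(tm_basis k) (f : E -> R^o) w) z.
Proof.
move=> oU Uz [df Df] dY; apply: diff_at_sum => k; apply: differentiableM.
  exact: differentiable_tm_coord.
by have [+ _] := Df (tm_basis k); apply.
Qed.

(** [along Y f] differentiates in a direction that moves with the point; expanded in constant
    directions it becomes a sum of products that can be differentiated again. *)
Lemma near_along_basis U f Y z : open U -> U z -> Ck_on U 2 (f : E -> R^o) ->
  {near z, along Y f =1
    fun w => \sum_k tm_coord k (Y w) * 'D_(tm_basis k) (f : E -> R^o) w}.
Proof.
move=> oU Uz [df Df]; apply: near_open oU Uz _ => w Uw.
by rewrite along_basisE //; apply: df.
Qed.

Lemma diff_at_along U f Y z : open U -> U z -> Ck_on U 2 (f : E -> R^o) ->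
  differentiable Y z -> diff_at (along Y f) z.
Proof.
move=> oU Uz Cf dY.
apply: near_eq_differentiable (diff_at_along_basis oU Uz Cf dY).
by apply: filterS (near_along_basis Y oU Uz Cf) => w.
Qed.

(** The Leibniz rule separates the derivative of the components of [Y], which gives a first-order
    term, from the Hessian of [f] on [X z] and [Y z]. *)
Lemma along_along U f X Y z : open U -> U z -> Ck_on U 2 (f : E -> R^o) ->
  differentiable Y z ->
  along X (along Y f) z = 'D_('D_(X z) Y z) (f : E -> R^o) z +
    \sum_k \sum_l tm_coord k (X z) * tm_coord l (Y z) *
      'D_(tm_basis k) ('D_(tm_basis l) (f : E -> R^o)) z.
Proof.
move=> oU Uz Cf dY; have [df Df] := Cf.
have dDf k : diff_at ('D_(tm_basis k) (f : E -> R^o)) z.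
  by have [+ _] := Df (tm_basis k); apply.
rewrite (along_near X (near_along_basis Y oU Uz Cf)) along_sum; last first.
  by move=> k; apply: differentiableM => //; apply: differentiable_tm_coord.
rewrite [in RHS]derive_tm_basis; last exact: df.
rewrite exchange_big -big_split /=; apply: eq_bigr => l _.
rewrite alongM //; last exact: differentiable_tm_coord.
rewrite addrC; congr (_ + _).
  rewrite along_basisE // mulr_sumr; apply: eq_bigr => k _.
  by rewrite mulrCA mulrA.
by rewrite /along derive_tm_coord // mulrC.
Qed.

Lemma along_lie_bracket U f X Y z : open U -> U z ->
  Ck_on U 2 (f : E -> R^o) -> differentiable X z -> differentiable Y z ->
  along X (along Y f) z - along Y (along X f) z = along (lie_bracket X Y) f z.
Proof.
move=> oU Uz Cf dX dY; have [df _] := Cf.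
rewrite (along_along X oU Uz Cf dY) (along_along Y oU Uz Cf dX).
set S1 := (X in _ - (_ + X)); set S2 := (X in _ + X - _).
(* The Hessian is symmetric, so only the first-order terms remain, and their difference is the
   bracket. *)
have -> : S1 = S2.
  rewrite /S1 exchange_big /=; apply: eq_bigr => k _; apply: eq_bigr => l _.
  rewrite (derive_comm (tm_basis l) (tm_basis k) oU Uz Cf).
  rewrite (mulrC (tm_coord l _)).
  reflexivity.
have red (a b c : R) : a + c - (b + c) = a - b by ring.
rewrite /= red.
rewrite /along /lie_bracket.
by rewrite [RHS]deriveE ?linearB /= -?deriveE //; apply: df.
Qed.

End Along.

(** * Flatness of parallelizable connections *)

Section Frames.
Context {R : realType} {n : nat}.
Local Notation E := (coordTM R n).
Implicit Types (X Y : E -> E) (U : set E) (z : E).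
Local Notation diff_at f z := (differentiable (f : E -> R^o) z).

(** Cartan's structure equation d omega + omega /\ omega, with [om X b a] standing for omega^a_b(X),
    lower index first. *)
Definition conn_curv (om : (E -> E) -> 'I_n -> 'I_n -> E -> R) X Y
    (b a : 'I_n) : E -> R := fun z =>
  along X (om Y b a) z - along Y (om X b a) z
  + (\sum_(e < n) om Y b e z * om X e a z - \sum_(e < n) om X b e z * om Y e a z)
  - om (lie_bracket X Y) b a z.

Definition frame_conn (H K : 'I_n -> 'I_n -> E -> R) X (b a : 'I_n) : E -> R :=
  fun z => \sum_(i < n) H i a z * along X (K b i) z.

Section Inverse.
Variables (U : set E) (H K : 'I_n -> 'I_n -> E -> R).
Hypothesis oU : open U.
Hypothesis CH : forall i a, Ck_on U 2 (H i a : E -> R^o).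
Hypothesis dK : forall b i z, U z -> diff_at (K b i) z.
Hypothesis KH : forall b a z, U z -> \sum_(i < n) K b i z * H i a z = (b == a)%:R.
Hypothesis HK : forall i j z, U z -> \sum_(a < n) H i a z * K a j z = (i == j)%:R.

Let dH i a z : U z -> diff_at (H i a) z.
Proof. by have [+ _] := CH i a; apply. Qed.

(** Differentiating K H = 1 moves the derivative from [K], known only to be differentiable, to [H],
    which is C^2; the right-hand side can therefore be differentiated once more. *)
Lemma frame_connE X b a z : U z ->
  frame_conn H K X b a z = - \sum_(i < n) K b i z * along X (H i a) z.
Proof.
move=> Uz; apply/eqP; rewrite -addr_eq0 -big_split /=; apply/eqP.
transitivity (along X (fun w => \sum_(i < n) K b i w * H i a w) z).
  rewrite along_sum; last by move=> i; apply: differentiableM; [apply: dK|apply: dH].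
  apply: eq_bigr => i _; rewrite alongM; [|exact: dK|exact: dH].
  by rewrite addrC.
rewrite (@along_near _ _ _ _ (fun=> (b == a)%:R)) ?along_cst //.
by apply: near_open oU Uz _ => w Uw; rewrite KH.
Qed.

(** Multiplying the connection form by [K] on the right undoes the factor [H], by [HK]. *)
Lemma along_coframe X b i z : U z ->
  along X (K b i) z = \sum_(a < n) frame_conn H K X b a z * K a i z.
Proof.
move=> Uz.
under eq_bigr do rewrite mulr_suml.
rewrite exchange_big /=.
under eq_bigr => j _ do
  (under eq_bigr do rewrite mulrAC; rewrite -mulr_suml HK //).
rewrite (bigD1 i) //= eqxx mul1r big1 ?addr0 // => j ji.
by rewrite (negbTE ji) mul0r.
Qed.

Let near_frame_conn X b a z : U z ->
  {near z, frame_conn H K X b a =1 fun w => - \sum_(i < n) K b i w * along X (H i a) w}.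
Proof. by move=> Uz; apply: near_open oU Uz _ => w Uw; rewrite frame_connE. Qed.

Let diff_at_sumKH X b a z : U z -> differentiable X z ->
  diff_at (fun w => \sum_(i < n) K b i w * along X (H i a) w) z.
Proof.
move=> Uz dX; apply: diff_at_sum => i; apply: differentiableM; first exact: dK.
exact: diff_at_along oU Uz (CH i a) dX.
Qed.

Lemma diff_at_frame_conn X b a z : U z -> differentiable X z ->
  diff_at (frame_conn H K X b a) z.
Proof.
move=> Uz dX; apply: near_eq_differentiable; last first.
  exact: differentiableN (diff_at_sumKH b a Uz dX).
by apply: filterS (near_frame_conn X b a Uz) => w.
Qed.

(** In - K (Y H), the derivative of [K] is the connection form times [K], so it reproduces a product
    of two connection forms; these products later cancel the quadratic part of the curvature. *)
Lemma along_frame_conn X Y b a z : U z -> differentiable Y z ->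
  along X (frame_conn H K Y b a) z =
  \sum_(e < n) frame_conn H K X b e z * frame_conn H K Y e a z
  - \sum_(i < n) K b i z * along X (along Y (H i a)) z.
Proof.
move=> Uz dY; rewrite (along_near X (near_frame_conn Y b a Uz)) alongN; last first.
  exact: diff_at_sumKH.
rewrite along_sum; last first.
  move=> i; apply: differentiableM; first exact: dK.
  exact: diff_at_along oU Uz (CH i a) dY.
have E1 i : along X (fun w => K b i w * along Y (H i a) w) z =
    K b i z * along X (along Y (H i a)) z +
    \sum_(e < n) frame_conn H K X b e z * (K e i z * along Y (H i a) z).
  rewrite alongM; [|exact: dK|exact: diff_at_along oU Uz (CH i a) dY].
  rewrite (along_coframe X b i Uz) mulr_sumr; congr (_ + _).
  by apply: eq_bigr => e _; rewrite mulrC mulrA.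
under eq_bigr do rewrite E1.
rewrite big_split /= opprD addrC; congr (_ + _).
rewrite exchange_big /= -sumrN; apply: eq_bigr => e _.
by rewrite -mulr_sumr (frame_connE Y e a Uz) mulrN.
Qed.

Lemma frame_conn_flat X Y b a z : U z -> differentiable X z ->
  differentiable Y z -> conn_curv (frame_conn H K) X Y b a z = 0.
Proof.
move=> Uz dX dY; rewrite /conn_curv !along_frame_conn //.
rewrite (frame_connE (lie_bracket X Y) b a Uz).
have -> : \sum_(i < n) K b i z * along (lie_bracket X Y) (H i a) z =
    \sum_(i < n) K b i z * along X (along Y (H i a)) z -
    \sum_(i < n) K b i z * along Y (along X (H i a)) z.
  rewrite -sumrB; apply: eq_bigr => i _.
  by rewrite -(along_lie_bracket oU Uz (CH i a) dX dY) mulrBr.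
(* [p] and [q] are the two products of connection forms, [s] and [t] the terms with second
   derivatives of [H] along the two orders of [X] and [Y]. *)
have red (p q s t : R) : p - s - (q - t) + (q - p) - - (s - t) = 0 by ring.
exact: red.
Qed.

End Inverse.

End Frames.

(** * Connection forms in the adapted frame *)

Section AdaptedFrame.
Context {R : realType} {n : nat}.
Local Notation E := (coordTM R n).
Implicit Types (N : E -> 'M[R]_n) (X Y : E -> E) (z : E) (D : @dconnection R n).
Local Notation diff_at f z := (differentiable (f : E -> R^o) z).

Lemma frame_combE N z (f g : 'I_n -> R) :
  \sum_(i < n) f i *: delta N i z + \sum_(a < n) g a *: vdel a z =
  (\row_i f i, \row_a (g a - \sum_(i < n) N z a i * f i)).
Proof.
apply: injective_projections => /=.
  rewrite !(big_morph fst (id1 := 0) (op1 := +%R)) //=.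
  rewrite [X in _ + X]big1 => [|a _]; last by rewrite scaler0.
  rewrite addr0 [RHS]row_sum_delta.
  by apply: eq_bigr => i _; rewrite mxE.
rewrite !(big_morph snd (id1 := 0) (op1 := +%R)) //=.
apply/rowP => a; rewrite !mxE !summxE addrC; congr (_ + _).
  rewrite (bigD1 a) //= big1 => [|b ba]; rewrite !mxE ?eqxx ?mulr1 ?addr0 //.
  by rewrite [a == b]eq_sym (negbTE ba) mulr0.
rewrite -sumrN; apply: eq_bigr => i _; rewrite !mxE mulrN mulrC; congr (- (_ * _)).
rewrite (bigD1 i) //= big1 => [|j ji]; rewrite !mxE ?eqxx ?mul1r ?addr0 //.
by rewrite (negbTE ji) mul0r.
Qed.

Lemma hcomp_frame N (f g : 'I_n -> E -> R) a :
  hcomp (fun z => \sum_(i < n) f i z *: delta N i z +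
                  \sum_(c < n) g c z *: vdel c z) a = f a.
Proof. by apply/funext => z; rewrite /hcomp frame_combE mxE. Qed.

Lemma vcomp_frame N (f g : 'I_n -> E -> R) a :
  vcomp N (fun z => \sum_(i < n) f i z *: delta N i z +
                    \sum_(c < n) g c z *: vdel c z) a = g a.
Proof.
apply/funext => z; rewrite /vcomp frame_combE mxE.
by under [X in _ + X]eq_bigr do rewrite mxE; rewrite subrK.
Qed.

Lemma frame_decomp N X z :
  X z = \sum_(i < n) hcomp X i z *: delta N i z +
        \sum_(c < n) vcomp N X c z *: vdel c z.
Proof.
rewrite frame_combE; apply: injective_projections => /=; apply/rowP => i.
  by rewrite mxE.
by rewrite mxE addrK.
Qed.

Lemma hcomp_delta N i a : hcomp (delta N i) a = fun=> (a == i)%:R.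
Proof. by apply/funext => z; rewrite /hcomp mxE. Qed.

Lemma vcomp_delta N i a : vcomp N (delta N i) a = fun=> 0.
Proof.
apply/funext => z; rewrite /vcomp !mxE addrC; apply/eqP; rewrite subr_eq0; apply/eqP.
by apply: eq_bigr => j _; rewrite !mxE mulrC.
Qed.

Lemma hcomp_vdel c a : hcomp (@vdel R n c) a = fun=> 0.
Proof. by apply/funext => z; rewrite /hcomp mxE. Qed.

Lemma vcomp_vdel N c a : vcomp N (vdel c) a = fun=> (a == c)%:R.
Proof.
apply/funext => z; rewrite /vcomp mxE big1 ?addr0 // => i _.
by rewrite mxE mulr0.
Qed.

Lemma hcompB X Y a z : hcomp (fun w => X w - Y w) a z = hcomp X a z - hcomp Y a z.
Proof. by rewrite /hcomp !mxE. Qed.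

Lemma vcompB N X Y a z :
  vcomp N (fun w => X w - Y w) a z = vcomp N X a z - vcomp N Y a z.
Proof.
rewrite /vcomp !mxE opprD addrACA -sumrB; congr (_ + _).
by apply: eq_bigr => i _; rewrite !mxE mulrBr.
Qed.

(* The connection forms of D on the horizontal and vertical bundles, at X. *)
Definition hform N D X (b a : 'I_n) : E -> R := fun z =>
  \sum_(i < n) hcomp X i z * Ghh D a b i z +
  \sum_(c < n) vcomp N X c z * Chv D a b c z.
Definition vform N D X (b a : 'I_n) : E -> R := fun z =>
  \sum_(i < n) hcomp X i z * Gvh D a b i z +
  \sum_(c < n) vcomp N X c z * Cvv D a b c z.

Lemma sum_pick (b : 'I_n) (F : 'I_n -> R) : \sum_(i < n) (i == b)%:R * F i = F b.
Proof.
rewrite (bigD1 b) //= eqxx mul1r big1 ?addr0 // => i ib.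
by rewrite (negbTE ib) mul0r.
Qed.

Lemma hcomp_nabla_delta N D X b a : hcomp (nabla N D X (delta N b)) a = hform N D X b a.
Proof.
rewrite hcomp_frame; apply/funext => z.
rewrite /nabla_h hcomp_delta along_cst add0r.
by under eq_bigr do rewrite hcomp_delta; rewrite sum_pick.
Qed.

Lemma vcomp_nabla_vdel N D X b a : vcomp N (nabla N D X (vdel b)) a = vform N D X b a.
Proof.
rewrite vcomp_frame; apply/funext => z.
rewrite /nabla_v vcomp_vdel along_cst add0r.
by under eq_bigr do rewrite vcomp_vdel; rewrite sum_pick.
Qed.

(** The components of [delta N b] are constant, so its covariant derivative is a column of the
    connection form. Only the horizontal components of that inner derivative enter the outer one,
    because a d-connection preserves the horizontal bundle. *)
Lemma hcomp_curv N D X Y b a z :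
  hcomp (curv N D X Y (delta N b)) a z = conn_curv (hform N D) X Y b a z.
Proof.
rewrite !hcompB /conn_curv hcomp_nabla_delta; congr (_ - _).
rewrite ![hcomp (nabla N D _ (nabla _ _ _ _)) _]hcomp_frame /nabla_h !hcomp_nabla_delta.
under eq_bigr do rewrite hcomp_nabla_delta.
under [X in _ - (_ + X)]eq_bigr do rewrite hcomp_nabla_delta.
by rewrite opprD addrACA.
Qed.

Lemma vcomp_curv N D X Y b a z :
  vcomp N (curv N D X Y (vdel b)) a z = conn_curv (vform N D) X Y b a z.
Proof.
rewrite !vcompB /conn_curv vcomp_nabla_vdel; congr (_ - _).
rewrite ![vcomp N (nabla N D _ (nabla _ _ _ _)) _]vcomp_frame /nabla_v !vcomp_nabla_vdel.
under eq_bigr do rewrite vcomp_nabla_vdel.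
under [X in _ - (_ + X)]eq_bigr do rewrite vcomp_nabla_vdel.
by rewrite opprD addrACA.
Qed.

Lemma along_frame N X (f : E -> R) z : diff_at f z ->
  along X f z = \sum_(i < n) hcomp X i z * along (delta N i) f z
              + \sum_(c < n) vcomp N X c z * along (vdel c) f z.
Proof.
move=> df; rewrite /along deriveE // {1}(frame_decomp N X z) linearD !linear_sum.
by congr (_ + _); apply: eq_bigr => i _; rewrite linearZ deriveE.
Qed.

Lemma sum_contract (p q h : 'I_n -> R) (u v : 'I_n -> 'I_n -> R) :
  \sum_(j < n) p j * (\sum_(i < n) h i * u i j) +
  \sum_(c < n) q c * (\sum_(i < n) h i * v i c) =
  \sum_(i < n) h i * (\sum_(j < n) p j * u i j + \sum_(c < n) q c * v i c).
Proof.
under eq_bigr do rewrite mulr_sumr.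
under [X in _ + X]eq_bigr do rewrite mulr_sumr.
rewrite exchange_big [X in _ + X]exchange_big -big_split; apply: eq_bigr => i _ /=.
rewrite mulrDr !mulr_sumr.
by congr (_ + _); apply: eq_bigr => j _; rewrite mulrCA.
Qed.

(** The coefficients involve derivatives along the adapted frame only; contraction with the
    components of [X] reassembles the derivative along [X], by linearity of the differential. *)
Lemma hform_canonical N lam X b a z :
  (forall i, diff_at (hcoframe lam i b) z) ->
  hform N (canonical_dconn N lam) X b a z =
  frame_conn (fun i => hcomp (lam i)) (fun b i => hcoframe lam i b) X b a z.
Proof.
move=> dK; rewrite /hform /frame_conn /=.
rewrite (sum_contract _ _ _ (fun i j => along (delta N j) (hcoframe lam i b) z)
  (fun i c => along (vdel c) (hcoframe lam i b) z)).
by apply: eq_bigr => i _; rewrite (along_frame N X (dK i)).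
Qed.

Lemma vform_canonical N lam X b a z :
  (forall i, diff_at (vcoframe N lam i b) z) ->
  vform N (canonical_dconn N lam) X b a z =
  frame_conn (fun i => vcomp N (lam i)) (fun b i => vcoframe N lam i b) X b a z.
Proof.
move=> dK; rewrite /vform /frame_conn /=.
rewrite (sum_contract _ _ _ (fun i j => along (delta N j) (vcoframe N lam i b) z)
  (fun i c => along (vdel c) (vcoframe N lam i b) z)).
by apply: eq_bigr => i _; rewrite (along_frame N X (dK i)).
Qed.

Lemma hform_delta N D i b a : hform N D (delta N i) b a = Ghh D a b i.
Proof.
apply/funext => z; rewrite /hform.
under eq_bigr do rewrite hcomp_delta.
under [X in _ + X]eq_bigr do rewrite vcomp_delta mul0r.
by rewrite sum_pick big1 ?addr0.
Qed.

Lemma vform_vdel N D c b a : vform N D (vdel c) b a = Cvv D a b c.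
Proof.
apply/funext => z; rewrite /vform addrC.
under eq_bigr do rewrite vcomp_vdel.
under [X in _ + X]eq_bigr do rewrite hcomp_vdel mul0r.
by rewrite sum_pick big1 ?addr0.
Qed.

End AdaptedFrame.

(** * The pencil D - t * torsion *)

Section Pencil.
Context {R : realType} {n : nat}.
Local Notation E := (coordTM R n).
Implicit Types (N : E -> 'M[R]_n) (X Y : E -> E) (z : E) (D : @dconnection R n).
Implicit Types (om A : (E -> E) -> 'I_n -> 'I_n -> E -> R).
Local Notation diff_at f z := (differentiable (f : E -> R^o) z).

Lemma conn_curv_eq_on (U : set E) om om' X Y b a z : open U -> U z ->
  (forall X b a w, U w -> om X b a w = om' X b a w) ->
  conn_curv om X Y b a z = conn_curv om' X Y b a z.
Proof.
move=> oU Uz eq_om; have near_om W c d : {near z, om W c d =1 om' W c d}.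
  by apply: near_open oU Uz _ => w Uw; apply: eq_om.
rewrite /conn_curv (along_near X (near_om Y b a)) (along_near Y (near_om X b a)).
rewrite (eq_om _ _ _ _ Uz).
congr (_ + (_ - _) - _); apply: eq_bigr => e _; by rewrite !(eq_om _ _ _ _ Uz).
Qed.

(* The exterior covariant derivative D^om A and A /\ A, evaluated at (X, Y). *)
Definition ext_cov om A X Y (b a : 'I_n) z : R :=
  along X (A Y b a) z - along Y (A X b a) z
  + \sum_(e < n) (om Y b e z * A X e a z + A Y b e z * om X e a z
                  - om X b e z * A Y e a z - A X b e z * om Y e a z)
  - A (lie_bracket X Y) b a z.
Definition wedge_sq A X Y (b a : 'I_n) z : R :=
  \sum_(e < n) A Y b e z * A X e a z - \sum_(e < n) A X b e z * A Y e a z.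

Lemma along_subZ X (f g : E -> R) (t : R) z : diff_at f z -> diff_at g z ->
  along X (fun w => f w - t * g w) z = along X f z - t * along X g z.
Proof.
move=> df dg.
have dt : diff_at (fun=> t) z by apply: differentiable_cst.
have dtg : diff_at (fun w => t * g w) z by exact: differentiableM dt dg.
have dNtg : diff_at (fun w => - (t * g w)) z by exact: differentiableN dtg.
by rewrite (alongD X df dNtg) (alongN X dtg) (alongM X dt dg) along_cst mulr0 addr0.
Qed.

Lemma conn_curv_pencil om A (t : R) X Y b a z :
  diff_at (om X b a) z -> diff_at (om Y b a) z ->
  diff_at (A X b a) z -> diff_at (A Y b a) z ->
  conn_curv (fun W d c w => om W d c w - t * A W d c w) X Y b a z =
  conn_curv om X Y b a z - t * ext_cov om A X Y b a z
  + t ^+ 2 * wedge_sq A X Y b a z.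
Proof.
move=> dX dY dAX dAY; rewrite /conn_curv !along_subZ // /ext_cov /wedge_sq.
rewrite -!sumrB.
set S := \sum_(e < n) _; set S1 := \sum_(e < n) _.
set S2 := \sum_(e < n) _; set S3 := \sum_(e < n) _.
have -> : S = S1 - t * S2 + t ^+ 2 * S3.
  rewrite /S /S1 /S2 /S3 !mulr_sumr -sumrB -big_split; apply: eq_bigr => e _ /=.
  move: (om _ _ _ _) (om _ _ _ _) (om _ _ _ _) (om _ _ _ _) => x1 x2 x3 x4.
  by move: (A _ _ _ _) (A _ _ _ _) (A _ _ _ _) (A _ _ _ _) => x5 x6 x7 x8; ring.
move: (along _ _ _) (along _ _ _) (along _ _ _) (along _ _ _) S1 S2 S3.
move=> x1 x2 x3 x4 S1 S2 S3.
by move: (om _ _ _ _) (A _ _ _ _) => x5 x6; ring.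
Qed.

Lemma wedge_sq_eq0l A X Y b a z : (forall d c, A X d c z = 0) ->
  wedge_sq A X Y b a z = 0.
Proof.
by move=> A0; rewrite /wedge_sq !big1 ?subrr // => e _; rewrite A0 ?mul0r ?mulr0.
Qed.

Lemma wedge_sq_eq0r A X Y b a z : (forall d c, A Y d c z = 0) ->
  wedge_sq A X Y b a z = 0.
Proof.
by move=> A0; rewrite /wedge_sq !big1 ?subrr // => e _; rewrite A0 ?mul0r ?mulr0.
Qed.

(** Stated abstractly to serve twice: [F] is [delta N] with [G] the coefficients [Ghh], or [vdel]
    with [Cvv]. The bracket term vanishes in both cases, which is what makes a formula purely in
    terms of the torsion possible. *)
Lemma torsion_pencil om A (F : 'I_n -> E -> E) (G : 'I_n -> 'I_n -> 'I_n -> E -> R)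
    (a b c d : 'I_n) z (t : R) :
  let T := fun a b c (w : E) => G a b c w - G a c b w in
  let cov := fun a b c d => along (F d) (T a b c) z
    + \sum_(e < n) T e b c z * G a e d z
    - \sum_(e < n) T a e c z * G e b d z
    - \sum_(e < n) T a b e z * G e c d z in
  (forall c b a, om (F c) b a = G a b c) ->
  (forall c b a, A (F c) b a = T a b c) ->
  A (lie_bracket (F c) (F d)) b a z = 0 ->
  - (t * ext_cov om A (F c) (F d) b a z) + t ^+ 2 * wedge_sq A (F c) (F d) b a z =
  t * (cov a b c d - cov a b d c)
  + t ^+ 2 * (\sum_(e < n) T e b c z * T a d e z - \sum_(e < n) T e b d z * T a c e z)
  + t * \sum_(e < n) T e c d z * T a b e z.
Proof.
move=> T cov omF AF A0; rewrite /ext_cov /wedge_sq /cov A0 !AF.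
have antisym i j k : T i j k z = - T i k j z by rewrite /T opprB.
have E1 : \sum_(e < n) (om (F d) b e z * A (F c) e a z + A (F d) b e z * om (F c) e a z
                  - om (F c) b e z * A (F d) e a z - A (F c) b e z * om (F d) e a z)
   = \sum_(e < n) T a e c z * G e b d z + \sum_(e < n) T e b d z * G a e c z
   - \sum_(e < n) T a e d z * G e b c z - \sum_(e < n) T e b c z * G a e d z.
  rewrite -!(big_split, sumrB) /=; apply: eq_bigr => e _; rewrite !AF !omF.
  by move: (G e b d z) (T a e c z) (T e b d z) (G a e c z) (G e b c z)
    (T a e d z) (T e b c z) (G a e d z) => *; ring.
have E2 : \sum_(e < n) A (F d) b e z * A (F c) e a z
        - \sum_(e < n) A (F c) b e z * A (F d) e a z =
    \sum_(e < n) T e b c z * T a d e z - \sum_(e < n) T e b d z * T a c e z.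
  rewrite -!sumrB; apply: eq_bigr => e _; rewrite !AF.
  rewrite (antisym a d e) (antisym a c e).
  by move: (T e b d z) (T a e c z) (T e b c z) (T a e d z) => *; ring.
have E3 : \sum_(e < n) T e c d z * T a b e z =
    \sum_(e < n) T a b e z * G e c d z - \sum_(e < n) T a b e z * G e d c z.
  rewrite -sumrB; apply: eq_bigr => e _; rewrite -mulrBr mulrC.
  by [].
rewrite E1 E2 E3.
move: (along _ _ z) (along _ _ z) => y1 y2.
by move: (\sum_(e < n) _) (\sum_(e < n) _) (\sum_(e < n) _) (\sum_(e < n) _)
  (\sum_(e < n) _) (\sum_(e < n) _) (\sum_(e < n) _) (\sum_(e < n) _) => *; ring.
Qed.

Definition dconn_pencil D (t : R) : dconnection := DConnection
  (fun a b c z => Ghh D a b c z - t * htors D a b c z) (Gvh D) (Chv D)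
  (fun a b c z => Cvv D a b c z - t * vtors D a b c z).

Lemma dual_pencil D : dual_dconn D = dconn_pencil D 1.
Proof.
rewrite /dual_dconn /dconn_pencil; congr DConnection;
  apply/funext => a; apply/funext => b; apply/funext => c; apply/funext => z.
  by rewrite mul1r /htors subKr.
by rewrite mul1r /vtors subKr.
Qed.

Lemma symmetric_pencil D : symmetric_dconn D = dconn_pencil D (1 / 2).
Proof.
rewrite /symmetric_dconn /dconn_pencil; congr DConnection;
  apply/funext => a; apply/funext => b; apply/funext => c; apply/funext => z.
  by rewrite /htors; move: (Ghh D _ _ _ z) (Ghh D _ _ _ z) => x y; field.
by rewrite /vtors; move: (Cvv D _ _ _ z) (Cvv D _ _ _ z) => x y; field.
Qed.

(** The torsion read as a matrix-valued 1-form in its last index, that is, the direction of the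
    pencil. *)
Definition htwist D X (b a : 'I_n) : E -> R := fun z =>
  \sum_(i < n) hcomp X i z * htors D a b i z.
Definition vtwist N D X (b a : 'I_n) : E -> R := fun z =>
  \sum_(c < n) vcomp N X c z * vtors D a b c z.

Lemma sum_subZ (x f g : 'I_n -> R) (t : R) :
  \sum_(i < n) x i * (f i - t * g i) =
  \sum_(i < n) x i * f i - t * \sum_(i < n) x i * g i.
Proof.
by rewrite mulr_sumr -sumrB; apply: eq_bigr => i _; rewrite mulrBr mulrCA.
Qed.

Lemma hform_pencil N D t :
  hform N (dconn_pencil D t) = fun X b a z => hform N D X b a z - t * htwist D X b a z.
Proof.
apply/funext => X; apply/funext => b; apply/funext => a; apply/funext => z.
by rewrite /hform /htwist /= sum_subZ addrAC.
Qed.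

Lemma vform_pencil N D t :
  vform N (dconn_pencil D t) = fun X b a z => vform N D X b a z - t * vtwist N D X b a z.
Proof.
apply/funext => X; apply/funext => b; apply/funext => a; apply/funext => z.
by rewrite /vform /vtwist /= sum_subZ addrA.
Qed.

Lemma htwist_delta N D i b a : htwist D (delta N i) b a = htors D a b i.
Proof.
apply/funext => z; rewrite /htwist.
by under eq_bigr do rewrite hcomp_delta; rewrite sum_pick.
Qed.

Lemma vtwist_vdel N D c b a : vtwist N D (vdel c) b a = vtors D a b c.
Proof.
apply/funext => z; rewrite /vtwist.
by under eq_bigr do rewrite vcomp_vdel; rewrite sum_pick.
Qed.

Lemma htwist_vdel D c b a : htwist D (vdel c) b a = fun=> 0.
Proof.
by apply/funext => z; rewrite /htwist big1 // => i _; rewrite hcomp_vdel mul0r.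
Qed.

Lemma vtwist_delta N D i b a : vtwist N D (delta N i) b a = fun=> 0.
Proof.
by apply/funext => z; rewrite /vtwist big1 // => c _; rewrite vcomp_delta mul0r.
Qed.

End Pencil.

(** * Traces of the quadratic torsion term *)

Section TorsionContractions.
Context {R : realType} {n : nat}.
Variables (g : 'I_n -> 'I_n -> R) (T : 'I_n -> 'I_n -> 'I_n -> R).
Hypothesis gC : forall b c, g b c = g c b.
Hypothesis TC : forall a b c, T a b c = - T a c b.

(** The trace of the torsion over its first two indices is minus the contraction C; that sign
    cancels the one from exchanging [b] and [c]. *)
Lemma sum_wedge_contract b c :
  \sum_(a < n) (\sum_(e < n) T e b c * T a a e - \sum_(e < n) T e b a * T a c e) =
  \sum_(a < n) (\sum_(e < n) T e a e) * T a c b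
  + \sum_(a < n) \sum_(e < n) T a c e * T e a b.
Proof.
rewrite sumrB -sumrN; congr (_ + _).
  rewrite exchange_big; apply: eq_bigr => e _ /=.
  rewrite mulr_suml; apply: eq_bigr => a _.
  by rewrite (TC e b c) (TC a a e) mulrNN mulrC.
apply: eq_bigr => a _; rewrite -sumrN; apply: eq_bigr => e _.
by rewrite (TC e b a) mulNr opprK mulrC.
Qed.

(** The part containing the contraction C is antisymmetric in [b] and [c], so the symmetric metric
    kills it: C is thus absent from (g) and (k), though present in (f) and (j). The rest is
    reordering of sums. *)
Lemma sum_metric_contract :
  \sum_(b < n) \sum_(c < n) g b c *
    (\sum_(a < n) (\sum_(e < n) T e a e) * T a c b
     + \sum_(a < n) \sum_(e < n) T a c e * T e a b) =
  \sum_(a < n) \sum_(b < n) \sum_(e < n) (\sum_(c < n) g b c * T a c e) * T e a b.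
Proof.
set u := fun c b => \sum_(a < n) (\sum_(e < n) T e a e) * T a c b.
have u0 : \sum_(b < n) \sum_(c < n) g b c * u c b = 0.
  set S := LHS.
  have SN : S = - S.
    rewrite {1}/S exchange_big /S -sumrN; apply: eq_bigr => b _ /=.
    rewrite -sumrN; apply: eq_bigr => c _; rewrite gC -mulrN; congr (_ * _).
    rewrite /u -sumrN; apply: eq_bigr => a _.
    by rewrite (TC a b c) mulrN.
  by lra.
under eq_bigr do (under eq_bigr do rewrite mulrDr; rewrite big_split /=).
rewrite big_split /= u0 add0r [RHS]exchange_big /=; apply: eq_bigr => b _.
under eq_bigr do rewrite mulr_sumr.
rewrite exchange_big /=; apply: eq_bigr => a _.
under eq_bigr do rewrite mulr_sumr.
rewrite exchange_big /=; apply: eq_bigr => e _.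
by rewrite mulr_suml; apply: eq_bigr => c _; rewrite mulrA.
Qed.

End TorsionContractions.

(** * Smoothness of frames and coframes *)

Section Smoothness.
Context {R : realType} {n : nat}.
Local Notation E := (coordTM R n).
Implicit Types (X Y : E -> E) (U : set E) (z : E) (N : E -> 'M[R]_n).
Local Notation diff_at f z := (differentiable (f : E -> R^o) z).

Lemma diff_at_big_sum (I : Type) (r : seq I) (F : I -> E -> R) z :
  (forall i, diff_at (F i) z) -> diff_at (fun w => \sum_(i <- r) F i w) z.
Proof.
move=> dF; elim: r => [|i r IH].
  by under eq_fun do rewrite big_nil; apply: differentiable_cst.
by under eq_fun do rewrite big_cons; apply: differentiableD.
Qed.

Lemma diff_at_big_prod (I : Type) (r : seq I) (F : I -> E -> R) z :
  (forall i, diff_at (F i) z) -> diff_at (fun w => \prod_(i <- r) F i w) z.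
Proof.
move=> dF; elim: r => [|i r IH].
  by under eq_fun do rewrite big_nil; apply: differentiable_cst.
by under eq_fun do rewrite big_cons; apply: differentiableM.
Qed.

Lemma diff_at_det m (M : E -> 'M[R]_m) z :
  (forall i j, diff_at (fun w => M w i j) z) -> diff_at (fun w => \det (M w)) z.
Proof.
move=> dM; apply: diff_at_big_sum => s.
apply: differentiableM; first exact: differentiable_cst.
exact: diff_at_big_prod.
Qed.

Lemma diff_at_invmx U m (M : E -> 'M[R]_m) i j z : open U -> U z ->
  (forall w, U w -> M w \in unitmx) ->
  (forall i j, diff_at (fun w => M w i j) z) ->
  diff_at (fun w => invmx (M w) i j) z.
Proof.
move=> oU Uz uM dM.
(* The cofactor formula for the inverse. [invmx] is defined by cases on invertibility, so it agrees
   with [f] only near [z]. *)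
pose f w := (\det (M w))^-1 * ((-1) ^+ (j + i) * \det (row' j (col' i (M w)))).
apply: (@near_eq_differentiable _ _ _ f).
  apply: near_open oU Uz _ => w Uw.
  by rewrite /f /invmx (uM _ Uw) !mxE.
apply: differentiableM.
  apply: differentiableV; first exact: diff_at_det.
  by have := uM _ Uz; rewrite unitmxE unitfE.
apply: differentiableM; first exact: differentiable_cst.
apply: diff_at_det => k l.
rewrite (_ : (fun _ => _) = fun w => M w (lift j k) (lift i l)) //.
by apply/funext => w; rewrite !mxE.
Qed.

Lemma hcomp_tm_coord X i : hcomp X i = fun w => tm_coord (lshift n i) (X w).
Proof. by apply/funext => w; rewrite /tm_coord row_mxEl. Qed.

Lemma vcomp_tm_coord N X a : vcomp N X a = fun w =>
  tm_coord (rshift n a) (X w) + \sum_(i < n) N w a i * tm_coord (lshift n i) (X w).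
Proof.
apply/funext => w; rewrite /vcomp /tm_coord row_mxEr.
by under [in RHS]eq_bigr do rewrite row_mxEl.
Qed.

Lemma Ck_on_tm_coord U k X l : open U -> Ck_on U k X ->
  Ck_on U k (fun w => tm_coord l (X w)).
Proof. by move=> oU; apply: (Ck_on_linear oU); apply: tm_coord_continuous. Qed.

Lemma Ck_on_hcomp U k X i : open U -> Ck_on U k X ->
  Ck_on U k (hcomp X i : E -> R^o).
Proof. by move=> oU CX; rewrite hcomp_tm_coord; apply: Ck_on_tm_coord. Qed.

Lemma Ck_on_vcomp U k N X a : open U ->
  (forall a i, Ck_on U k (fun w => N w a i : R^o)) -> Ck_on U k X ->
  Ck_on U k (vcomp N X a : E -> R^o).
Proof.
move=> oU CN CX; rewrite vcomp_tm_coord; apply: (Ck_onD oU).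
  exact: Ck_on_tm_coord.
apply: (Ck_on_sum oU) => i; apply: (Ck_onM oU) => //; exact: Ck_on_tm_coord.
Qed.

Lemma diff_at_hcomp X i z : differentiable X z -> diff_at (hcomp X i) z.
Proof. by move=> dX; rewrite hcomp_tm_coord; apply: differentiable_tm_coord. Qed.

Lemma diff_at_vcomp N X a z : (forall a i, diff_at (fun w => N w a i) z) ->
  differentiable X z -> diff_at (vcomp N X a) z.
Proof.
move=> dN dX; rewrite vcomp_tm_coord; apply: differentiableD.
  exact: differentiable_tm_coord.
apply: diff_at_sum => i; apply: differentiableM => //.
exact: differentiable_tm_coord.
Qed.

Lemma differentiable_vdel c z : differentiable (@vdel R n c) z.
Proof. exact: differentiable_cst. Qed.

Lemma differentiable_delta N i z : (forall a, diff_at (fun w => N w a i) z) ->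
  differentiable (delta N i) z.
Proof.
move=> dN.
rewrite (_ : delta N i = cst (delta_mx 0 i, 0) +
    \sum_(a < n) (fun w => (- N w a i) *: ((0, delta_mx 0 a) : E))).
  apply: differentiableD; first exact: differentiable_cst.
  apply: differentiable_sum => a; apply: differentiableZl.
  exact: differentiableN.
apply/funext => w; rewrite /GRing.add /= fct_sumE; apply: injective_projections => /=.
  rewrite (big_morph fst (id1 := 0) (op1 := +%R)) //= big1 ?addr0 // => a _.
  by rewrite scaler0.
rewrite (big_morph snd (id1 := 0) (op1 := +%R)) //= add0r.
rewrite [LHS]row_sum_delta; apply: eq_bigr => a _; congr (_ *: _).
rewrite !mxE; congr (- _); rewrite (bigD1 i) //= big1 => [|j ji].
  by rewrite !mxE !eqxx mul1r addr0.
by rewrite !mxE (negbTE ji) mul0r.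
Qed.

Lemma hcomp_lie_bracket X Y i z : differentiable X z -> differentiable Y z ->
  hcomp (lie_bracket X Y) i z = along X (hcomp Y i) z - along Y (hcomp X i) z.
Proof.
move=> dX dY; rewrite hcompB !hcomp_tm_coord /along !derive_tm_coord //.
Qed.

Lemma lie_bracket_vdel c d z : lie_bracket (@vdel R n c) (vdel d) z = 0.
Proof. by rewrite /lie_bracket !derive_cst subrr. Qed.

End Smoothness.

Lemma row_inj_unitmx (F : fieldType) n (A : 'M[F]_n) :
  (forall v : 'rV_n, v *m A = 0 -> v = 0) -> A \in unitmx.
Proof.
move=> A_inj; rewrite -row_free_unit -kermx_eq0; apply/rowV0P => v.
by move/sub_kermxP; apply: A_inj.
Qed.

(** * Flatness of the canonical connection and curvature of its pencil *)

Section CanonicalPencil.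
Context {R : realType} {n : nat}.
Local Notation E := (coordTM R n).
Local Notation diff_at f z := (differentiable (f : E -> R^o) z).
Variables (U : set E) (N : E -> 'M[R]_n) (lam : 'I_n -> E -> E).
Hypothesis oU : open U.
Hypothesis CN : forall a i, Ck_on U 2 (fun w => N w a i : R^o).
Hypothesis Clam : forall i, Ck_on U 2 (lam i).
Hypothesis hunit : forall w, U w -> hframe lam w \in unitmx.
Hypothesis vunit : forall w, U w -> vframe N lam w \in unitmx.

Let dN a i z : U z -> diff_at (fun w => N w a i) z.
Proof. by have [+ _] := CN a i; apply. Qed.

Let dlam i z : U z -> differentiable (lam i) z.
Proof. by have [+ _] := Clam i; apply. Qed.

Lemma diff_at_hcoframe i b z : U z -> diff_at (hcoframe lam i b) z.
Proof.
move=> Uz; apply: (diff_at_invmx _ _ oU Uz hunit) => j a.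
under eq_fun do rewrite mxE; exact: diff_at_hcomp (dlam j Uz).
Qed.

Lemma diff_at_vcoframe i b z : U z -> diff_at (vcoframe N lam i b) z.
Proof.
move=> Uz; apply: (diff_at_invmx _ _ oU Uz vunit) => j a.
under eq_fun do rewrite mxE.
by apply: diff_at_vcomp (dlam j Uz) => c k; apply: dN.
Qed.

Let hKH b a z : U z ->
  \sum_(i < n) hcoframe lam i b z * hcomp (lam i) a z = (b == a)%:R.
Proof.
move=> /hunit /mulVmx /matrixP /(_ b a); rewrite !mxE => <-.
by apply: eq_bigr => i _; rewrite [in RHS]mxE.
Qed.

Let hHK i j z : U z ->
  \sum_(a < n) hcomp (lam i) a z * hcoframe lam j a z = (i == j)%:R.
Proof.
move=> /hunit /mulmxV /matrixP /(_ i j); rewrite !mxE => <-.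
by apply: eq_bigr => a _; rewrite [in RHS]mxE.
Qed.

Let vKH b a z : U z ->
  \sum_(i < n) vcoframe N lam i b z * vcomp N (lam i) a z = (b == a)%:R.
Proof.
move=> /vunit /mulVmx /matrixP /(_ b a); rewrite !mxE => <-.
by apply: eq_bigr => i _; rewrite [in RHS]mxE.
Qed.

Let vHK i j z : U z ->
  \sum_(a < n) vcomp N (lam i) a z * vcoframe N lam j a z = (i == j)%:R.
Proof.
move=> /vunit /mulmxV /matrixP /(_ i j); rewrite !mxE => <-.
by apply: eq_bigr => a _; rewrite [in RHS]mxE.
Qed.

Let CH i a : Ck_on U 2 (hcomp (lam i) a : E -> R^o).
Proof. exact: Ck_on_hcomp. Qed.

Let CV i a : Ck_on U 2 (vcomp N (lam i) a : E -> R^o).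
Proof. exact: Ck_on_vcomp. Qed.

Local Notation D := (canonical_dconn N lam).

Lemma canonical_hflat X Y b a z : U z -> differentiable X z ->
  differentiable Y z -> conn_curv (hform N D) X Y b a z = 0.
Proof.
move=> Uz dX dY; rewrite (@conn_curv_eq_on _ _ U _ (frame_conn
    (fun i => hcomp (lam i)) (fun b i => hcoframe lam i b))) //.
  exact: (frame_conn_flat oU CH (fun b i => @diff_at_hcoframe i b) hKH hHK).
move=> W c d w Uw; apply: hform_canonical => i; exact: diff_at_hcoframe.
Qed.

Lemma canonical_vflat X Y b a z : U z -> differentiable X z ->
  differentiable Y z -> conn_curv (vform N D) X Y b a z = 0.
Proof.
move=> Uz dX dY; rewrite (@conn_curv_eq_on _ _ U _ (frame_conn
    (fun i => vcomp N (lam i)) (fun b i => vcoframe N lam i b))) //.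
  exact: (frame_conn_flat oU CV (fun b i => @diff_at_vcoframe i b) vKH vHK).
move=> W c d w Uw; apply: vform_canonical => i; exact: diff_at_vcoframe.
Qed.

(** Its definition contains derivatives of the coframe; near [z] it equals the frame form, whose
    differentiability comes from the expression - K (X H). *)
Lemma diff_at_hform X b a z : U z -> differentiable X z ->
  diff_at (hform N D X b a) z.
Proof.
move=> Uz dX; apply: near_eq_differentiable; last first.
  exact: (diff_at_frame_conn oU CH (fun b i => @diff_at_hcoframe i b) hKH b a Uz dX).
apply: near_open oU Uz _ => w Uw; apply/esym/hform_canonical => i.
exact: diff_at_hcoframe.
Qed.

Lemma diff_at_vform X b a z : U z -> differentiable X z ->
  diff_at (vform N D X b a) z.
Proof.
move=> Uz dX; apply: near_eq_differentiable; last first.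
  exact: (diff_at_frame_conn oU CV (fun b i => @diff_at_vcoframe i b) vKH b a Uz dX).
apply: near_open oU Uz _ => w Uw; apply/esym/vform_canonical => i.
exact: diff_at_vcoframe.
Qed.

Lemma differentiable_frame_delta i z : U z -> differentiable (delta N i) z.
Proof. by move=> Uz; apply: differentiable_delta => a; apply: dN. Qed.

Lemma diff_at_htwist X b a z : U z -> differentiable X z ->
  diff_at (htwist D X b a) z.
Proof.
move=> Uz dX; apply: diff_at_sum => i; apply: differentiableM.
  exact: diff_at_hcomp.
(* The coefficients are read back as values of the connection form on the adapted frame. *)
apply: differentiableB; rewrite -(hform_delta N).
  exact: diff_at_hform (differentiable_frame_delta _ Uz).
exact: diff_at_hform (differentiable_frame_delta _ Uz).
Qed.

Lemma diff_at_vtwist X b a z : U z -> differentiable X z ->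
  diff_at (vtwist N D X b a) z.
Proof.
move=> Uz dX; apply: diff_at_sum => c; apply: differentiableM.
  by apply: diff_at_vcomp => // *; apply: dN.
apply: differentiableB; rewrite -(vform_vdel N).
  exact: diff_at_vform (differentiable_vdel _ _).
exact: diff_at_vform (differentiable_vdel _ _).
Qed.

Lemma hcurv_pencil t X Y b a z : U z -> differentiable X z ->
  differentiable Y z ->
  hcomp (curv N (dconn_pencil D t) X Y (delta N b)) a z =
  - (t * ext_cov (hform N D) (htwist D) X Y b a z)
  + t ^+ 2 * wedge_sq (htwist D) X Y b a z.
Proof.
move=> Uz dX dY; rewrite hcomp_curv hform_pencil conn_curv_pencil.
- by rewrite canonical_hflat // sub0r.
- exact: diff_at_hform.
- exact: diff_at_hform.
- exact: diff_at_htwist.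
- exact: diff_at_htwist.
Qed.

Lemma vcurv_pencil t X Y b a z : U z -> differentiable X z ->
  differentiable Y z ->
  vcomp N (curv N (dconn_pencil D t) X Y (vdel b)) a z =
  - (t * ext_cov (vform N D) (vtwist N D) X Y b a z)
  + t ^+ 2 * wedge_sq (vtwist N D) X Y b a z.
Proof.
move=> Uz dX dY; rewrite vcomp_curv vform_pencil conn_curv_pencil.
- by rewrite canonical_vflat // sub0r.
- exact: diff_at_vform.
- exact: diff_at_vform.
- exact: diff_at_vtwist.
- exact: diff_at_vtwist.
Qed.

End CanonicalPencil.

(** * Invertibility of the two frame matrices of an EAP-space *)

Section EAP.
Context {R : realType} {n : nat} {M : smooth_manifold R n}.

Lemma tm_dom_open (c : chart M) : open (tm_dom c).
Proof.
apply: (@open_comp _ _ fst); last exact: coord_open.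
by move=> z _; apply: cvg_fst.
Qed.

Variables (NC : nonlinear_connection M) (L : eap_space NC) (c : chart M).

Lemma eap_hframe_unit z : tm_dom c z ->
  hframe (fun i => L i c) z \in unitmx.
Proof.
move=> cz; apply: row_inj_unitmx => v v0.
have k0 : forall i, v 0 i = 0.
  apply: (@eap_hfree _ _ _ _ L c z cz (fun i => v 0 i)); rewrite /hpart.
  under eq_bigr do rewrite scaler_sumr.
  rewrite exchange_big big1 //= => a _.
  under eq_bigr do rewrite scalerA; rewrite -scaler_suml.
  have /rowP /(_ a) := v0; rewrite !mxE; under eq_bigr do rewrite mxE.
  by move=> ->; rewrite scale0r.
by apply/rowP => i; rewrite k0 mxE.
Qed.

Lemma eap_vframe_unit z : tm_dom c z ->
  vframe (NC c) (fun i => L i c) z \in unitmx.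
Proof.
move=> cz; apply: row_inj_unitmx => v v0.
have k0 : forall i, v 0 i = 0.
  apply: (@eap_vfree _ _ _ _ L c z cz (fun i => v 0 i)); rewrite /vpart.
  under eq_bigr do rewrite scaler_sumr.
  rewrite exchange_big big1 //= => a _.
  under eq_bigr do rewrite scalerA; rewrite -scaler_suml.
  have /rowP /(_ a) := v0; rewrite !mxE; under eq_bigr do rewrite mxE.
  by move=> ->; rewrite scale0r.
by apply/rowP => i; rewrite k0 mxE.
Qed.

End EAP.

Lemma hmetric_inv_sym (R : realType) n (lam : 'I_n -> coordTM R n -> coordTM R n) b c z :
  hmetric_inv lam b c z = hmetric_inv lam c b z.
Proof.
rewrite /hmetric_inv; set g := hmetric lam z.
have gT : g^T = g.
  by apply/matrixP => i j; rewrite !mxE; apply: eq_bigr => k _; rewrite mulrC.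
by rewrite -[in LHS]gT -trmx_inv mxE.
Qed.

Lemma vmetric_inv_sym (R : realType) n (N : coordTM R n -> 'M[R]_n)
    (lam : 'I_n -> coordTM R n -> coordTM R n) b c z :
  vmetric_inv N lam b c z = vmetric_inv N lam c b z.
Proof.
rewrite /vmetric_inv; set g := vmetric N lam z.
have gT : g^T = g.
  by apply/matrixP => i j; rewrite !mxE; apply: eq_bigr => k _; rewrite mulrC.
by rewrite -[in LHS]gT -trmx_inv mxE.
Qed.

(* Eliminates the linear terms between t = 1/2 and t = 1. *)
Lemma pencil_half_one (R : realType) (x q s : R) :
  1 / 2 * x + (1 / 2) ^+ 2 * q + 1 / 2 * s =
  1 / 2 * (1 * x + 1 ^+ 2 * q + 1 * s) - 1 / 4 * q.
Proof. by field. Qed.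

(** * Components and contractions of the curvature of the pencil *)

Section Curvatures.
Context {R : realType} {n : nat}.
Local Notation E := (coordTM R n).
Variables (U : set E) (N : E -> 'M[R]_n) (lam : 'I_n -> E -> E).
Hypothesis oU : open U.
Hypothesis CN : forall a i, Ck_on U 2 (fun w => N w a i : R^o).
Hypothesis Clam : forall i, Ck_on U 2 (lam i).
Hypothesis hunit : forall w, U w -> hframe lam w \in unitmx.
Hypothesis vunit : forall w, U w -> vframe N lam w \in unitmx.
Variable z : E.
Hypothesis Uz : U z.

Local Notation D := (canonical_dconn N lam).
Local Notation La a b c := (htors D a b c z).
Local Notation T a b c := (vtors D a b c z).

Let dd i : differentiable (delta N i) z := differentiable_frame_delta CN i Uz.
Let dv c : differentiable (@vdel R n c) z := differentiable_vdel c z.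

(** The bracket of two horizontal frame fields is vertical, since their horizontal components are
    constant. *)
Lemma htwist_lie_delta c d b a : htwist D (lie_bracket (delta N c) (delta N d)) b a z = 0.
Proof.
rewrite /htwist big1 // => i _.
by rewrite hcomp_lie_bracket // !hcomp_delta !along_cst subrr mul0r.
Qed.

Lemma htwist_lie_vdel c d b a : htwist D (lie_bracket (vdel c) (vdel d)) b a z = 0.
Proof.
by rewrite /htwist big1 // => i _; rewrite /hcomp lie_bracket_vdel mxE mul0r.
Qed.

Lemma vtwist_lie_vdel c d b a : vtwist N D (lie_bracket (vdel c) (vdel d)) b a z = 0.
Proof.
rewrite /vtwist big1 // => i _; rewrite /vcomp lie_bracket_vdel mxE big1 ?add0r ?mul0r //.
by move=> j _; rewrite mxE mulr0.
Qed.

Lemma Rh_pencil t a b c d : Rh N (dconn_pencil D t) a b c d z =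
  t * (hcov N D (htors D) a b c d z - hcov N D (htors D) a b d c z)
  + t ^+ 2 * (\sum_(e < n) La e b c * La a d e - \sum_(e < n) La e b d * La a c e)
  + t * \sum_(e < n) La e c d * La a b e.
Proof.
rewrite /Rh (hcurv_pencil oU CN Clam hunit) //.
exact: (@torsion_pencil _ _ _ _ (delta N) (Ghh D) a b c d z t
  (fun c b a => hform_delta N D c b a) (fun c b a => htwist_delta N D c b a)
  (htwist_lie_delta c d b a)).
Qed.

Lemma Sv_pencil t a b c d : Sv N (dconn_pencil D t) a b c d z =
  t * (vcov D (vtors D) a b c d z - vcov D (vtors D) a b d c z)
  + t ^+ 2 * (\sum_(e < n) T e b c * T a d e - \sum_(e < n) T e b d * T a c e)
  + t * \sum_(e < n) T e c d * T a b e.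
Proof.
rewrite /Sv (vcurv_pencil oU CN Clam vunit) //.
exact: (@torsion_pencil _ _ _ _ (@vdel R n) (Cvv D) a b c d z t
  (fun c b a => vform_vdel N D c b a) (fun c b a => vtwist_vdel N D c b a)
  (vtwist_lie_vdel c d b a)).
Qed.

(** [htwist] vanishes on both vertical arguments and on their bracket, so the whole pencil is as
    flat here as the canonical connection. *)
Lemma Sh_pencil t a b c d : Sh N (dconn_pencil D t) a b c d z = 0.
Proof.
rewrite /Sh (hcurv_pencil oU CN Clam hunit) // wedge_sq_eq0l; last first.
  by move=> i j; rewrite htwist_vdel.
rewrite /ext_cov htwist_lie_vdel !htwist_vdel !along_cst big1 => [|e _]; first by ring.
by rewrite !htwist_vdel !mulr0 !mul0r !subr0 addr0.
Qed.

(** [vtwist] vanishes on horizontal arguments, so the curvature is linear in [t], and comparison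
    with t = 1 suffices. *)
Lemma Rv_pencil t a b c d : Rv N (dconn_pencil D t) a b c d z =
  t * Rv N (dconn_pencil D 1) a b c d z.
Proof.
rewrite /Rv !(vcurv_pencil oU CN Clam vunit) // wedge_sq_eq0l; last first.
  by move=> i j; rewrite vtwist_delta.
by move: (ext_cov _ _ _ _ _ _ _) => x; ring.
Qed.

(** Here the vertical first argument annihilates the quadratic term; in [Pv_pencil] the horizontal
    second argument does. *)
Lemma Ph_pencil t a b c d : Ph N (dconn_pencil D t) a b c d z =
  t * Ph N (dconn_pencil D 1) a b c d z.
Proof.
rewrite /Ph !(hcurv_pencil oU CN Clam hunit) // wedge_sq_eq0l; last first.
  by move=> i j; rewrite htwist_vdel.
by move: (ext_cov _ _ _ _ _ _ _) => x; ring.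
Qed.

Lemma Pv_pencil t a b c d : Pv N (dconn_pencil D t) a b c d z =
  t * Pv N (dconn_pencil D 1) a b c d z.
Proof.
rewrite /Pv !(vcurv_pencil oU CN Clam vunit) // wedge_sq_eq0r; last first.
  by move=> i j; rewrite vtwist_delta.
by move: (ext_cov _ _ _ _ _ _ _) => x; ring.
Qed.

Let LaC a b c : La a b c = - La a c b.
Proof. by rewrite /htors opprB. Qed.

Let TC a b c : T a b c = - T a c b.
Proof. by rewrite /vtors opprB. Qed.

Lemma Rich_symmetric b c : Rich N (dconn_pencil D (1 / 2)) b c z =
  1 / 2 * Rich N (dconn_pencil D 1) b c z
  - 1 / 4 * (\sum_(a < n) hcontr D a z * La a c b
             + \sum_(a < n) \sum_(e < n) La a c e * La e a b).
Proof.
rewrite -(sum_wedge_contract LaC) /Rich !mulr_sumr -sumrB.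
apply: eq_bigr => a _; rewrite !Rh_pencil.
exact: pencil_half_one.
Qed.

Lemma Ricv_symmetric b c : Ricv N (dconn_pencil D (1 / 2)) b c z =
  1 / 2 * Ricv N (dconn_pencil D 1) b c z
  - 1 / 4 * (\sum_(a < n) vcontr D a z * T a c b
             + \sum_(a < n) \sum_(e < n) T a c e * T e a b).
Proof.
rewrite -(sum_wedge_contract TC) /Ricv !mulr_sumr -sumrB.
apply: eq_bigr => a _; rewrite !Sv_pencil.
exact: pencil_half_one.
Qed.

Lemma scalar_h_symmetric : scalar_h N lam (dconn_pencil D (1 / 2)) z =
  1 / 2 * scalar_h N lam (dconn_pencil D 1) z
  - 1 / 4 * \sum_(a < n) \sum_(b < n) \sum_(e < n)
              htors_raised lam D a b e z * La e a b.
Proof.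
rewrite /scalar_h /htors_raised.
rewrite -(sum_metric_contract (g := fun b c => hmetric_inv lam b c z)
  (fun b c => hmetric_inv_sym lam b c z) LaC).
rewrite !mulr_sumr -sumrB; apply: eq_bigr => b _.
rewrite !mulr_sumr -sumrB; apply: eq_bigr => c _; rewrite Rich_symmetric /hcontr.
by move: (_ + _) (Rich _ _ _ _ _) (hmetric_inv _ _ _ _) => x1 x2 x3; ring.
Qed.

Lemma scalar_v_symmetric : scalar_v N lam (dconn_pencil D (1 / 2)) z =
  1 / 2 * scalar_v N lam (dconn_pencil D 1) z
  - 1 / 4 * \sum_(a < n) \sum_(b < n) \sum_(e < n)
              vtors_raised N lam D a b e z * T e a b.
Proof.
rewrite /scalar_v /vtors_raised.
rewrite -(sum_metric_contract (g := fun b c => vmetric_inv N lam b c z)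
  (fun b c => vmetric_inv_sym N lam b c z) TC).
rewrite !mulr_sumr -sumrB; apply: eq_bigr => b _.
rewrite !mulr_sumr -sumrB; apply: eq_bigr => c _; rewrite Ricv_symmetric /vcontr.
by move: (_ + _) (Ricv _ _ _ _ _) (vmetric_inv _ _ _ _ _) => x1 x2 x3; ring.
Qed.

End Curvatures.

Theorem theorem3p6 (R : realType) (n : nat) (M : smooth_manifold R n)
    (NC : nonlinear_connection M) (L : eap_space NC)
    (ch : chart M) (z : coordTM R n) (hz : tm_dom ch z) :
  let N := NC ch in
  let lam := fun i : 'I_n => L i ch in
  let D := canonical_dconn N lam in
  let Dt := dual_dconn D in
  let Dh := symmetric_dconn D in
  let La := fun alpha mu nu : 'I_n => htors D alpha mu nu z in
  let T := fun a b c : 'I_n => vtors D a b c z in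
  (forall alpha beta b c : 'I_n, Sh N Dh alpha beta b c z = 0)
  /\ (* (a) *)
  (forall alpha beta nu mu : 'I_n,
    Rh N Dh alpha beta nu mu z =
      1 / 2 * (hcov N D (htors D) alpha beta nu mu z
               - hcov N D (htors D) alpha beta mu nu z)
      + 1 / 4 * (\sum_(e < n) La e beta nu * La alpha mu e
                 - \sum_(e < n) La e beta mu * La alpha nu e)
      + 1 / 2 * \sum_(e < n) La e nu mu * La alpha beta e)
  /\ (* (b) *)
  (forall a b nu mu : 'I_n, Rv N Dh a b nu mu z = 1 / 2 * Rv N Dt a b nu mu z)
  /\ (* (c) *)
  (forall alpha beta mu c : 'I_n,
    Ph N Dh alpha beta mu c z = 1 / 2 * Ph N Dt alpha beta mu c z)
  /\ (* (d) *)
  (forall a b mu c : 'I_n, Pv N Dh a b mu c z = 1 / 2 * Pv N Dt a b mu c z)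
  /\ (* (e) *)
  (forall a b c d : 'I_n,
    Sv N Dh a b c d z =
      1 / 2 * (vcov D (vtors D) a b c d z - vcov D (vtors D) a b d c z)
      + 1 / 4 * (\sum_(e < n) T e b c * T a d e - \sum_(e < n) T e b d * T a c e)
      + 1 / 2 * \sum_(e < n) T e d c * T a e b)
  /\ (* (f) *)
  (forall beta nu : 'I_n,
    Rich N Dh beta nu z =
      1 / 2 * Rich N Dt beta nu z
      - 1 / 4 * (\sum_(alpha < n) hcontr D alpha z * La alpha nu beta
                 + \sum_(alpha < n) \sum_(e < n) La alpha nu e * La e alpha beta))
  /\ (* (g) *)
  (scalar_h N lam Dh z =
      1 / 2 * scalar_h N lam Dt z
      - 1 / 4 * \sum_(alpha < n) \sum_(beta < n) \sum_(e < n)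
                  htors_raised lam D alpha beta e z * La e alpha beta)
  /\ (* (h) *)
  (forall beta c : 'I_n, Pch N Dh beta c z = 1 / 2 * Pch N Dt beta c z)
  /\ (* (i) *)
  (forall b mu : 'I_n, Pcv N Dh b mu z = 1 / 2 * Pcv N Dt b mu z)
  /\ (* (j) *)
  (forall b d : 'I_n,
    Ricv N Dh b d z =
      1 / 2 * Ricv N Dt b d z
      - 1 / 4 * (\sum_(a < n) vcontr D a z * T a d b
                 + \sum_(a < n) \sum_(e < n) T a d e * T e a b))
  /\ (* (k) *)
  (scalar_v N lam Dh z =
      1 / 2 * scalar_v N lam Dt z
      - 1 / 4 * \sum_(a < n) \sum_(b < n) \sum_(e < n)
                  vtors_raised N lam D a b e z * T e a b).
Proof.
move=> N lam D Dt Dh La T; rewrite /Dt /Dh dual_pencil symmetric_pencil {Dt Dh}.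
have oU := @tm_dom_open _ _ _ ch.
have CN a i : Ck_on (tm_dom ch) 2 (fun w => N w a i : R^o) by apply: ncoeff_smooth.
have Clam i : Ck_on (tm_dom ch) 2 (lam i) by apply: vf_smooth.
have hunit : forall w, tm_dom ch w -> hframe lam w \in unitmx :=
  @eap_hframe_unit _ _ _ _ L ch.
have vunit : forall w, tm_dom ch w -> vframe N lam w \in unitmx :=
  @eap_vframe_unit _ _ _ _ L ch.
do 11?[split].
- by move=> *; rewrite (Sh_pencil oU CN Clam hunit hz).
- move=> a b c d; rewrite (Rh_pencil oU CN Clam hunit hz) /La.
  set x1 := (hcov _ _ _ _ _ _ _ _ - _); set x2 := (_ - _); set x3 := \sum_(e < n) _.
  by move: x1 x2 x3 => *; field.
- by move=> *; apply: (Rv_pencil oU CN Clam vunit hz).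
- by move=> *; apply: (Ph_pencil oU CN Clam hunit hz).
- by move=> *; apply: (Pv_pencil oU CN Clam vunit hz).
- move=> a b c d; rewrite (Sv_pencil oU CN Clam vunit hz) /T.
  (* Formula (e) has the lower indices of both factors exchanged with respect to [Sv_pencil]; the
     two signs cancel. *)
  have -> : \sum_(e < n) vtors D e d c z * vtors D a e b z =
            \sum_(e < n) vtors D e c d z * vtors D a b e z.
    by apply: eq_bigr => e _; rewrite /vtors -mulrNN !opprB.
  set x1 := (vcov _ _ _ _ _ _ _ - _); set x2 := (_ - _); set x3 := \sum_(e < n) _.
  by move: x1 x2 x3 => *; field.
- by move=> *; apply: (Rich_symmetric oU CN Clam hunit hz).
- exact: (scalar_h_symmetric oU CN Clam hunit hz).
- move=> b c; rewrite /Pch mulrN mulr_sumr; congr (- _); apply: eq_bigr => a _.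
  exact: (Ph_pencil oU CN Clam hunit hz).
- move=> b c; rewrite /Pcv mulr_sumr; apply: eq_bigr => a _.
  exact: (Pv_pencil oU CN Clam vunit hz).
- by move=> *; apply: (Ricv_symmetric oU CN Clam vunit hz).
- exact: (scalar_v_symmetric oU CN Clam vunit hz).
Qed.
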